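(* Let $T$ be a complete continuous logic theory. The following are equivalent: (1) $T$ is $n$-dependent; (2) every $G_{n+1,p}$-indiscernible sequence is $\mathcal{L}_{op}$-indiscernible; (3) every $G_{n+1}$-indiscernible sequence is order indiscernible.
   Context: Continuous logic in the sense of Ben Yaacov–Berenstein–Henson–Usvyatsov; $\mathfrak{C}$ a monster model of $T$. A formula $f(x,y_0,\dots,y_{n-1})$ has $IP_n$ if there are reals $r<s$ and $(a_{0,i},\dots,a_{n-1,i})_{i<\omega}$ such that for every finite $w\subseteq\omega^n$ there is $b_w$ with $f(b_w,a_{0,i_0},\dots,a_{n-1,i_{n-1}})\leq r$ iff $(i_0,\dots,i_{n-1})\in w$ and $\geq s$ iff $(i_0,\dots,i_{n-1})\notin w$; $T$ is $n$-dependent if no formula has $IP_n$. Languages: $\mathcal{L}_{op}=\{<,P_0,\dots,P_n\}$, $\mathcal{L}_{og}=\{<,R\}$, $\mathcal{L}_{opg}=\{<,R,P_0,\dots,P_n\}$ with $R$ $(n+1)$-ary and $P_i$ unary. An ordered $(n+1)$-uniform hypergraph: $<$ a linear order, $R$ symmetric and holding only on tuples of pairwise distinct elements. An ordered $(n+1)$-partite $(n+1)$-uniform hypergraph: $M=P_0\sqcup\dots\sqcup P_n$, $R$ symmetric, $R(a_0,\dots,a_n)$ implies $\{a_0,\dots,a_n\}$ meets each $P_i$ in exactly one point, $<$ a linear order with $P_0<\dots<P_n$. $G_{n+1}$ and $G_{n+1,p}$ are the Fraïssé limits of the classes of finite ordered $(n+1)$-uniform hypergraphs and of finite ordered $(n+1)$-partite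 $(n+1)$-uniform hypergraphs, respectively. For an index structure $\mathcal{I}$ and a language $\mathcal{L}_*$ of it, a sequence $(a_g)_{g\in\mathcal{I}}$ is indiscernible with respect to $\mathcal{L}_*$ if any two finite tuples of indices with the same quantifier-free $\mathcal{L}_*$-type give tuples of the same type. $G_{n+1,p}$-indiscernible means with respect to $\mathcal{L}_{opg}$; $\mathcal{L}_{op}$-indiscernible means with respect to $\mathcal{L}_{op}$; $G_{n+1}$-indiscernible means with respect to $\mathcal{L}_{og}$; order indiscernible means with respect to $\{<\}$. *)

(* Defs.v *)
From HB Require Import structures.
From mathcomp Require Import all_boot all_order all_algebra all_fingroup.
From mathcomp Require Import all_classical all_reals all_analysis.
Set Implicit Arguments.
Unset Strict Implicit.
Unset Printing Implicit Defensive.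
Import Order.TTheory GRing.Theory Num.Theory.
Import numFieldNormedType.Exports.
Local Open Scope classical_set_scope.
Local Open Scope ring_scope.

(* The interval attached to a predicate symbol p is [plow p, phigh p]; pmod and
   fmod are the moduli of uniform continuity, only relevant at positive reals.
   Constant symbols are function symbols of arity 0. *)
Record signature (R : realType) := Signature {
  psym : Type;
  pred_arity : psym -> nat;
  plow : psym -> R;
  phigh : psym -> R;
  pmod : psym -> R -> R;
  pmod_gt0 : forall p e, 0 < e -> 0 < pmod p e;
  fsym : Type;
  fun_arity : fsym -> nat;
  fmod : fsym -> R -> R;
  fmod_gt0 : forall f e, 0 < e -> 0 < fmod f e;
  diam : R }.

Record mstructure (R : realType) (L : signature R) := MStructure {
  mcarrier :> metricType R;
  minhabited : inhabited mcarrier;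
  mcomplete : forall F : set_system mcarrier,
    ProperFilter F -> cauchy F -> exists x : mcarrier, F --> x;
  mdiam : forall x y : mcarrier, mdist x y <= diam L;
  pinterp : forall p : psym L, ('I_(pred_arity p) -> mcarrier) -> R;
  pinterp_itv : forall p x, plow p <= @pinterp p x <= phigh p;
  pinterp_unif : forall p e x y, 0 < e ->
    (forall i, mdist (x i) (y i) < pmod p e) ->
    `|@pinterp p x - @pinterp p y| <= e;
  finterp : forall f : fsym L, ('I_(fun_arity f) -> mcarrier) -> mcarrier;
  finterp_unif : forall f e x y, 0 < e ->
    (forall i, mdist (x i) (y i) < fmod f e) ->
    mdist (@finterp f x) (@finterp f y) <= e }.

Section Formulas.
Variables (R : realType) (L : signature R).

Inductive term (V : Type) : Type :=
| Var of V
| App (f : fsym L) of ('I_(fun_arity f) -> term V).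

(* [formula V] is the type of formulas whose free variables are in [V]; the
   quantifiers bind the variable [None] of [option V]. *)
Inductive formula (V : Type) : Type :=
| Dist of term V & term V
| Pred (p : psym L) of ('I_(pred_arity p) -> term V)
| Conn (k : nat) (u : 'rV[R]_k -> R) of continuous u & ('I_k -> formula V)
| Sup of formula (option V)
| Inf of formula (option V).

Variable M : mstructure L.

Fixpoint teval (V : Type) (s : V -> M) (t : term V) : M :=
  match t with
  | Var v => s v
  | App f ts => finterp (fun i => teval s (ts i))
  end.

Definition vcons (V : Type) (a : M) (s : V -> M) (v : option V) : M :=
  if v is Some w then s w else a.

Fixpoint feval (V : Type) (phi : formula V) : (V -> M) -> R :=
  match phi with
  | Dist t1 t2 => fun s => mdist (teval s t1) (teval s t2)
  | Pred p ts => fun s => pinterp (fun i => teval s (ts i))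
  | Conn k u _ phis => fun s => u (\row_i feval (phis i) s)
  | Sup psi => fun s => sup (range (fun a : M => feval psi (vcons a s)))
  | Inf psi => fun s => inf (range (fun a : M => feval psi (vcons a s)))
  end.

(* [V] may be infinite; each formula involves finitely many variables. *)
Definition same_type (V : Type) (a b : V -> M) : Prop :=
  forall phi : formula V, feval phi a = feval phi b.

Definition automorphism (s : M -> M) : Prop :=
  [/\ bijective s,
      forall x y, mdist (s x) (s y) = mdist x y,
      forall p x, pinterp (p := p) (s \o x) = pinterp x
    & forall f x, finterp (f := f) (s \o x) = s (finterp x)].

End Formulas.

Arguments Var {R L V}.
Arguments App {R L V}.

(* An element phi of a theory stands for the closed condition phi = 0. *)
Definition theory (R : realType) (L : signature R) : Type :=
  set (formula L void).

Definition sentence_value (R : realType) (L : signature R)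
  (M : mstructure L) (phi : formula L void) : R :=
  feval phi (of_void M).

Definition Th (R : realType) (L : signature R) (M : mstructure L) :
  theory L := [set phi | sentence_value M phi = 0].

Definition models (R : realType) (L : signature R) (M : mstructure L)
  (T : theory L) : Prop := T `<=` Th M.

Definition complete_theory (R : realType) (L : signature R) (T : theory L) :
  Prop := exists M : mstructure L, T = Th M.

(* |X| < |K|; the type K plays the role of the cardinal kappa. *)
Definition small (K X : Type) : Prop := ~ ([set: K] #<= [set: X])%card.

Section Monster.
Variables (R : realType) (L : signature R) (K : Type) (M : mstructure L).

Definition satisfies (p : nat) (A : set M) (Gamma : set (formula L ('I_p + A)))
  (b : 'I_p -> M) : Prop :=
  forall phi, Gamma phi ->
    feval phi (fun v => match v with inl i => b i | inr a => set_val a end) = 0.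

Definition saturated : Prop :=
  forall (A : set M), small K A ->
  forall (p : nat) (Gamma : set (formula L ('I_p + A))),
    (forall Delta, finite_set Delta -> Delta `<=` Gamma ->
       exists b, satisfies Delta b) ->
    exists b, satisfies Gamma b.

Definition strongly_homogeneous : Prop :=
  forall (C : Type) (a b : C -> M), small K C -> same_type a b ->
    exists2 s : M -> M, automorphism s & forall c, s (a c) = b c.

End Monster.

Definition monster_model (R : realType) (L : signature R) (K : Type)
  (T : theory L) (M : mstructure L) : Prop :=
  [/\ small K nat, small K (psym L + fsym L)%type, models M T,
      saturated K M & strongly_homogeneous K M].

(* [f] is a formula f(x, y_0, ..., y_{n-1}) where x is a p-tuple of variables
   and y_i a (q i)-tuple; all values are computed in the monster model [M]. *)
Definition has_IP (R : realType) (L : signature R) (M : mstructure L)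
  (n p : nat) (q : 'I_n -> nat)
  (f : formula L ('I_p + {i : 'I_n & 'I_(q i)})) : Prop :=
  exists (r s : R) (a : forall i : 'I_n, nat -> 'I_(q i) -> M),
    r < s /\
    forall w : set ('I_n -> nat), finite_set w ->
    exists b : 'I_p -> M,
    forall j : 'I_n -> nat,
      let v := feval f (fun x => match x with
        | inl k => b k
        | inr u => a (tag u) (j (tag u)) (tagged u)
        end) in
      (v <= r <-> w j) /\ (s <= v <-> ~ w j).

Definition n_dependent (R : realType) (L : signature R) (n : nat)
  (M : mstructure L) : Prop :=
  forall p q f, ~ @has_IP R L M n p q f.

Record rlang := RLang { rsym : Type; rarity : rsym -> nat }.

Record rstruct (L : rlang) := RStruct {
  rcarrier :> Type;
  rinterp : forall s : rsym L, ('I_(rarity s) -> rcarrier) -> Prop }.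

Section Relational.
Variable L : rlang.

Definition rembedding (A B : rstruct L) (f : A -> B) : Prop :=
  injective f /\
  forall (s : rsym L) (x : 'I_(rarity s) -> A),
    rinterp (f \o x) <-> rinterp x.

Definition risomorphism (A B : rstruct L) (f : A -> B) : Prop :=
  rembedding f /\ bijective f.

Definition rsub (G : rstruct L) (A : set G) : rstruct L :=
  @RStruct L A (fun s x => rinterp (fun i => set_val (x i))).

Definition rfinite (A : rstruct L) : Prop := finite_set [set: A].

Definition ultrahomogeneous (G : rstruct L) : Prop :=
  forall (A B : set G) (f : rsub A -> rsub B),
    finite_set A -> finite_set B -> risomorphism f ->
    exists2 s : G -> G, risomorphism s &
      forall x : rsub A, s (set_val x) = set_val (f x).

Definition age (G A : rstruct L) : Prop :=
  rfinite A /\ exists f : A -> G, rembedding f.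

Definition fraisse_limit (C : rstruct L -> Prop) (G : rstruct L) : Prop :=
  [/\ countable [set: G], ultrahomogeneous G & forall A, age G A <-> C A].

Inductive qf_formula (V : Type) : Type :=
| QEq of V & V
| QRel (s : rsym L) of ('I_(rarity s) -> V)
| QNot of qf_formula V
| QAnd of qf_formula V & qf_formula V.

Fixpoint qf_sat (G : rstruct L) (V : Type) (g : V -> G) (phi : qf_formula V) :
  Prop :=
  match phi with
  | QEq x y => g x = g y
  | QRel s x => rinterp (g \o x)
  | QNot psi => ~ qf_sat g psi
  | QAnd psi1 psi2 => qf_sat g psi1 /\ qf_sat g psi2
  end.

Definition same_qf_type (G : rstruct L) (k : nat) (g h : 'I_k -> G) : Prop :=
  forall phi : qf_formula 'I_k, qf_sat g phi <-> qf_sat h phi.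

(* A sequence of J-tuples of elements of M indexed by G. *)
Definition indiscernible (R : realType) (S : signature R)
  (M : mstructure S) (J : Type) (G : rstruct L) (a : G -> J -> M) : Prop :=
  forall (k : nat) (g h : 'I_k -> G), same_qf_type g h ->
    same_type (fun v : 'I_k * J => a (g v.1) v.2)
              (fun v : 'I_k * J => a (h v.1) v.2).

End Relational.

Inductive o_sym := o_lt.
Definition Lo := @RLang o_sym (fun=> 2%N).

Inductive og_sym := og_lt | og_R.
Definition Log (n : nat) :=
  @RLang og_sym (fun s => match s with og_lt => 2%N | og_R => n.+1 end).

Inductive op_sym (n : nat) := op_lt | op_P of 'I_n.+1.
Definition Lop (n : nat) :=
  @RLang (op_sym n) (fun s => match s with op_lt => 2%N | op_P _ => 1%N end).

Inductive opg_sym (n : nat) := opg_lt | opg_R | opg_P of 'I_n.+1.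
Definition Lopg (n : nat) :=
  @RLang (opg_sym n)
    (fun s => match s with opg_lt => 2%N | opg_R => n.+1 | opg_P _ => 1%N end).

Arguments op_lt {n}.
Arguments opg_lt {n}.
Arguments opg_R {n}.

Definition o_reduct (n : nat) (G : rstruct (Log n)) : rstruct Lo :=
  @RStruct Lo G (fun s => match s with o_lt => @rinterp _ G og_lt end).

Definition op_reduct (n : nat) (G : rstruct (Lopg n)) : rstruct (Lop n) :=
  @RStruct (Lop n) G (fun s => match s with
    | op_lt => @rinterp _ G opg_lt
    | op_P i => @rinterp _ G (opg_P i)
    end).

Definition linear_order (A : Type) (lt : A -> A -> Prop) : Prop :=
  [/\ forall x, ~ lt x x,
      forall x y z, lt x y -> lt y z -> lt x z
    & forall x y, [\/ lt x y, x = y | lt y x]].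

Definition symmetric_rel (A : Type) (k : nat) (E : ('I_k -> A) -> Prop) : Prop :=
  forall (x : 'I_k -> A) (s : {perm 'I_k}), E (x \o s) <-> E x.

Section Hypergraphs.
Variable n : nat.

Definition ordered_hypergraph (G : rstruct (Log n)) : Prop :=
  let lt x y := @rinterp _ G og_lt (tnth [tuple x; y]) in
  let E := @rinterp _ G og_R in
  [/\ linear_order lt, symmetric_rel E & forall x, E x -> injective x].

Definition ordered_partite_hypergraph (G : rstruct (Lopg n)) : Prop :=
  let lt x y := @rinterp _ G opg_lt (tnth [tuple x; y]) in
  let E := @rinterp _ G opg_R in
  let P i x := @rinterp _ G (opg_P i) (fun=> x) in
  [/\ forall x, exists! i, P i x,
      symmetric_rel E,
      forall x, E x -> forall i, exists! y, range x y /\ P i y,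
      linear_order lt
    & forall (i j : 'I_n.+1) x y, (i < j)%N -> P i x -> P j y -> lt x y].

Definition is_Gn1 (G : rstruct (Log n)) : Prop :=
  fraisse_limit (fun A => rfinite A /\ ordered_hypergraph A) G.

Definition is_Gn1p (G : rstruct (Lopg n)) : Prop :=
  fraisse_limit (fun A => rfinite A /\ ordered_partite_hypergraph A) G.

End Hypergraphs.

(* Main.v *)
(** The cycle is (1) => (3) => (2) => (1).

    (1) => (3): if a G_{n+1}-indiscernible sequence is not order indiscernible,
    some formula takes different values on two increasing tuples whose edge sets
    differ in a single edge x_0 (walk from one edge set to the other). Blowing up
    the first n vertices of x_0 into infinitely many copies, and the last one
    into copies coding the finite subsets of omega^n, gives IP_n.

    (3) => (2): the cover G_{n+1} x {0..n}, with edges the transversals of edges,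
    embeds in G_{n+1,p}; grouping the n + 1 copies of a vertex turns a
    G_{n+1,p}-indiscernible sequence into a G_{n+1}-indiscernible one.

    (2) => (1): IP_n codes every (n+1)-ary relation on a finite set V by a
    V-indexed sequence. By the Ramsey theorem for finite ordered hypergraphs
    (the partite construction, from Hales-Jewett and Ramsey) and saturation
    there is a G_{n+1}-indiscernible sequence whose edges are defined by a
    formula. Restrict it to G_{n+1,p}, which embeds in G_{n+1} after
    forgetting the parts. *)

Require Import Defs.
From mathcomp Require Import all_boot all_order all_algebra all_fingroup.
From mathcomp Require Import all_classical all_reals all_analysis.
From mathcomp Require Import lra.
Set Implicit Arguments.
Unset Strict Implicit.
Unset Printing Implicit Defensive.
Import Order.TTheory GRing.Theory Num.Theory.
Import numFieldNormedType.Exports.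

(** Edges are unordered while the variables of a formula are not, so edge patterns are always read
    on increasing tuples. There a quantifier-free type in G_{n+1} is just a set of increasing
    (n+1)-tuples of positions, which can be prescribed at will; the relation coded through IP_n may
    be asymmetric, and the Ramsey host needs no order. Continuous values shape the two implications
    that involve IP_n. To exploit IP_n, colourings must be finite, so values are rounded to
    precision e for finitely many formulas; exact indiscernibility comes back in an ultralimit.
    Saturation speaks of finitely many variables, so this limit is realized one coordinate at a
    time. The tuples of a given sequence may be infinite, but a formula has finite support; this
    keeps regrouped tuples finite, hence small. *)

(** * The Hales-Jewett theorem *)

Section HalesJewett.
Variable T : finType.

(* [None] marks the active coordinates of a line. *)
Definition line_point (I : finType) (l : {ffun I -> option T}) (a : T) :
  {ffun I -> T} := [ffun i => odflt a (l i)].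

(** Confining the constant letters to [s] lets the induction on the alphabet stay inside one type
    [T]; in the partite construction it guarantees that these letters are copies of the pattern. *)
Definition is_line (s : seq T) (I : finType) (l : {ffun I -> option T}) :=
  (exists i, l i = None) /\ forall i a, l i = Some a -> a \in s.

Definition mono_line (s : seq T) (I : finType) (K : Type)
    (C : {ffun I -> T} -> K) (l : {ffun I -> option T}) :=
  is_line s l /\
  forall a b, a \in s -> b \in s -> C (line_point l a) = C (line_point l b).

Definition ffun_join (I J : finType) (U : Type) (v : {ffun I -> U})
    (w : {ffun J -> U}) : {ffun I + J -> U} :=
  [ffun k => match k with inl i => v i | inr j => w j end].

Lemma line_point_join (I J : finType) (l : {ffun I -> option T})
    (m : {ffun J -> option T}) a :
  line_point (ffun_join l m) a = ffun_join (line_point l a) (line_point m a).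
Proof. by apply/ffunP => -[i|j]; rewrite !ffunE. Qed.

Lemma line_point_cst (I : finType) (v : {ffun I -> T}) a :
  line_point [ffun i => Some (v i)] a = v.
Proof. by apply/ffunP => i; rewrite !ffunE. Qed.

(** Colour focusing: the lines have pairwise distinct colours on the letters [y :: s] and all meet
    at [f] for the letter [x]. The colour at the focus either agrees with that of some line, which
    becomes monochromatic, or is new and gives one more line. The letter [y] is there to read off
    the colour of a line. *)
Lemma color_focusing (x y : T) (s : seq T) (K : finType) :
  (forall K' : finType, exists I : finType,
     forall C : {ffun I -> T} -> K', exists l, mono_line (y :: s) C l) ->
  forall m, exists I : finType, forall C : {ffun I -> T} -> K,
    (exists l, mono_line (x :: y :: s) C l) \/
    exists (ls : seq ({ffun I -> option T} * K)) (f : {ffun I -> T}),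
      [/\ size ls = m, uniq (map snd ls), forall i, f i \in x :: y :: s
        & forall p, p \in ls ->
            [/\ is_line (x :: y :: s) p.1, line_point p.1 x = f
              & forall a, a \in y :: s -> C (line_point p.1 a) = p.2]].
Proof.
move=> HJ; elim=> [|m [I IHI]].
  exists unit => C; right; exists [::], [ffun => x].
  by split => // i; rewrite ffunE mem_head.
have [J HJJ] := HJ {ffun {ffun I -> T} -> K}.
exists (I + J)%type => C.
(* A word of the second block is coloured by the whole colouring it induces on the first, so along
   [l'] the letters of [y :: s] are interchangeable whatever the first block is. *)
have [l' [[[j0 l'j0] l'ys] l'C]] := HJJ (fun w => [ffun v => C (ffun_join v w)]).
have ysub a : a \in y :: s -> a \in x :: y :: s.
  by move=> ays; rewrite in_cons ays orbT.
have l'E v a : a \in y :: s ->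
    C (ffun_join v (line_point l' a)) = C (ffun_join v (line_point l' y)).
  move=> ays; have := l'C a y ays (mem_head _ _).
  by move/ffunP/(_ v); rewrite !ffunE.
have [[l [[[i0 li0] ls] lC]]|[ls [f [size_ls uniq_ls f_in lsP]]]] :=
  IHI (fun v => C (ffun_join v (line_point l' y))).
  left; exists (ffun_join l [ffun j => Some (line_point l' y j)]); split.
    split; first by exists (inl i0); rewrite ffunE.
    move=> [i|j] a; rewrite !ffunE; first exact: ls.
    case E : (l' j) => [b|] /= [<-]; first exact/ysub/(l'ys _ _ E).
    by apply: ysub; rewrite mem_head.
  move=> a b ax bx; rewrite !line_point_join !line_point_cst.
  exact: lC.
have [/mapP[p pls pE]|c0_notin] :=
  boolP (C (ffun_join f (line_point l' y)) \in map snd ls).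
  have [[[i0 li0] lin] pf pC] := lsP _ pls.
  have key a : a \in x :: y :: s ->
      C (ffun_join (line_point p.1 a) (line_point l' y)) = p.2.
    by rewrite in_cons => /orP[/eqP ->|/pC //]; rewrite pf -pE.
  left; exists (ffun_join p.1 [ffun j => Some (line_point l' y j)]); split.
    split; first by exists (inl i0); rewrite ffunE.
    move=> [i|j] a; rewrite !ffunE; first exact: lin.
    case E : (l' j) => [b|] /= [<-]; first exact/ysub/(l'ys _ _ E).
    by apply: ysub; rewrite mem_head.
  by move=> a b ax bx; rewrite !line_point_join !line_point_cst !key.
right.
(* The new line moves only in the second block; the old ones now move in both, so that all meet at
   the letter [x]. *)
exists ((ffun_join [ffun i => Some (f i)] l', C (ffun_join f (line_point l' y)))
  :: [seq (ffun_join p.1 l', p.2) | p <- ls]), (ffun_join f (line_point l' x)).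
split.
- by rewrite /= size_map size_ls.
- by rewrite /= -map_comp c0_notin.
- move=> [i|j]; rewrite !ffunE //.
  by case E : (l' j) => [b|] /=; [exact/ysub/(l'ys _ _ E)|exact: mem_head].
- move=> p; rewrite in_cons => /orP[/eqP ->|/mapP[q /lsP [[[i0 qi0] qin] qf qC] ->]] /=.
    split=> [| |a ays].
    - split; first by exists (inr j0); rewrite ffunE.
      move=> [i|j] a; rewrite !ffunE; first by move=> [<-].
      by move=> /l'ys /ysub.
    - by rewrite line_point_join line_point_cst.
    - by rewrite line_point_join line_point_cst l'E.
  split=> [| |a ays].
  - split; first by exists (inl i0); rewrite ffunE.
    by move=> [i|j] a; rewrite !ffunE; [exact: qin|move=> /l'ys /ysub].
  - by rewrite line_point_join qf.
  - by rewrite line_point_join l'E // qC.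
Qed.

Theorem hales_jewett (s : seq T) (K : finType) :
  exists I : finType, forall C : {ffun I -> T} -> K, exists l, mono_line s C l.
Proof.
elim: s K => [|x [|y s] IH] K.
- exists unit => C; exists [ffun => None]; split=> //; split.
    by exists tt; rewrite ffunE.
  by move=> i a; rewrite ffunE.
- exists unit => C; exists [ffun => None]; split.
    by split=> [|i a]; [exists tt; rewrite ffunE|rewrite ffunE].
  by move=> a b; rewrite !inE => /eqP -> /eqP ->.
(* One more focused line than there are colours cannot exist. *)
- have [I HI] := color_focusing x K IH #|K|.+1.
  exists I => C; have [//|[ls [f [sz un _ _]]]] := HI C.
  have := max_card (mem (map snd ls)).
  by rewrite (card_uniqP un) size_map sz ltnn.
Qed.

End HalesJewett.

(** * Ramsey's theorem for subsequences of a list *)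

Section Ramsey.

(** The colour of a subsequence of length s + 1 depends only on its first element, which carries
    that colour as a label; a pigeonhole on the labels then yields a homogeneous list. *)
Fixpoint min_homogeneous (T : eqType) (K : eqType) (s : nat) (X : seq T -> K)
    (P : seq (T * K)) : Prop :=
  if P is p :: P' then
    (forall u, subseq u (map fst P') -> size u = s -> X (p.1 :: u) = p.2) /\
    min_homogeneous s X P'
  else True.

Lemma min_homogeneous_sub (T K : eqType) s (X : seq T -> K) P Q :
  subseq Q P -> min_homogeneous s X P -> min_homogeneous s X Q.
Proof.
elim: P Q => [|p P IH] [|q Q] //=; case: eqP => [->|_] sQP [pX hP].
  split; last exact: IH.
  by move=> u uQ; apply: pX; apply: subseq_trans uQ (map_subseq _ sQP).
by apply: (IH (q :: Q)).
Qed.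

Lemma min_homogeneous_const (T K : eqType) s (X : seq T -> K) Q d :
  min_homogeneous s X Q -> all (fun p => p.2 == d) Q ->
  forall u, subseq u (map fst Q) -> size u = s.+1 -> X u = d.
Proof.
elim: Q => [|q Q IH] /=; first by move=> _ _ [|? ?].
move=> [qX hQ] /andP[/eqP qd Qd] [|x u] //= sub [sz].
by move: sub; case: eqP => [-> /qX -> //|_ sub]; apply: IH => //=; rewrite sz.
Qed.

Lemma filter_pigeonhole (T : Type) (K : finType) (f : T -> K) a (l : seq T) :
  #|K| * a < size l -> exists d, a <= count (fun x => f x == d) l.
Proof.
move=> lt_l; apply: contrapT => /forallNP small_cnt.
have : size l <= \sum_(d : K) a.
  have -> : size l = \sum_d count (fun x => f x == d) l.
    elim: l {lt_l small_cnt} => [|x l IH] /=; first by rewrite big1.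
    rewrite big_split /= -IH (bigD1 (f x)) //= eqxx big1 ?addn0 //.
    by move=> d /negPf; rewrite eq_sym => ->.
  apply: leq_sum => d _; apply: ltnW; rewrite ltnNge.
  by apply/negP; apply: small_cnt.
by rewrite sum_nat_const leqNgt lt_l.
Qed.

Theorem ramsey (s : nat) (K : finType) (a : nat) :
  exists N, forall (T : eqType) (l : seq T) (X : seq T -> K), N <= size l ->
  exists l', [/\ subseq l' l, size l' = a &
    forall u u', subseq u l' -> subseq u' l' -> size u = s -> size u' = s ->
      X u = X u'].
Proof.
elim: s a => [|s IH] a.
  exists a => T l X le_a; exists (take a l); split; rewrite ?take_subseq //.
    by rewrite size_takel.
  by move=> u u' _ _ /size0nil -> /size0nil ->.
have [N HN] : exists N, forall (T : eqType) (l : seq T) (X : seq T -> K),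
    N <= size l -> exists P, [/\ subseq (map fst P) l,
      size P = (#|K| * a).+1 & min_homogeneous s X P].
  elim: (_.+1) => [|m [N HN]].
    by exists 0 => T l X _; exists [::]; split; rewrite ?sub0seq.
  have [N' HN'] := IH N.
  exists N'.+1 => T [//|x l] X; rewrite ltnS => le_l.
  have [l1 [l1l sz1 hom1]] := HN' T l (fun u => X (x :: u)) le_l.
  have [|P [Pl1 szP hP]] := HN T l1 X; first by rewrite sz1.
  (* By homogeneity of [l1] any s of its elements give the same label; if [l1] is too short, there
     is no tuple to label. *)
  exists ((x, X (x :: take s l1)) :: P); split => /=.
  - by rewrite eqxx; apply: subseq_trans Pl1 l1l.
  - by rewrite szP.
  - split=> // u uP szu; apply: hom1 => //; rewrite ?take_subseq //.
      exact: subseq_trans uP Pl1.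
    rewrite size_takel // -szu; apply: leq_trans (size_subseq uP) _.
    exact: size_subseq.
exists N => T l X /(HN T l X) [P [Pl szP hP]].
have [|d a_le] := @filter_pigeonhole _ _ (@snd T K) a P; first by rewrite szP.
pose Q := take a [seq p <- P | p.2 == d].
have szQ : size Q = a by rewrite size_takel // size_filter.
have QP : subseq Q P by apply: subseq_trans (take_subseq _ _) (filter_subseq _ _).
have Qd : all (fun p => p.2 == d) Q.
  by apply/allP => p /mem_take; rewrite mem_filter => /andP[].
have hQ := min_homogeneous_sub QP hP.
exists (map fst Q); split.
- exact: subseq_trans (map_subseq _ QP) Pl.
- by rewrite size_map.
- by move=> u u' uQ uQ' szu szu'; rewrite !(min_homogeneous_const hQ Qd).
Qed.

Lemma ramsey_upto (K : nat -> finType) (b a : nat) :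
  exists N, forall (T : eqType) (l : seq T) (X : forall s, seq T -> K s),
  N <= size l ->
  exists l', [/\ subseq l' l, size l' = a &
    forall s u u', s < b -> subseq u l' -> subseq u' l' ->
      size u = s -> size u' = s -> X s u = X s u'].
Proof.
elim: b a => [|b IH] a.
  exists a => T l X le_a; exists (take a l).
  by rewrite take_subseq size_takel.
have [N HN] := ramsey b (K b) a; have [N' HN'] := IH N.
exists N' => T l X /(HN' T l X) [l1 [l1l sz1 hom1]].
have [|l2 [l2l1 sz2 hom2]] := HN T l1 (X b); first by rewrite sz1.
exists l2; split=> [|//|s u u']; first exact: subseq_trans l2l1 l1l.
rewrite ltnS leq_eqVlt => /orP[/eqP -> ul ul' szu szu'|lt_sb ul ul' szu szu'].
  exact: hom2.
by apply: hom1 => //; [apply: subseq_trans ul l2l1|apply: subseq_trans ul' l2l1].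
Qed.

End Ramsey.

(** * The partite construction and the structural Ramsey theorem *)

Definition increasing (k m : nat) (f : 'I_k -> 'I_m) : Prop :=
  forall i j : 'I_k, i < j -> f i < f j.

Lemma increasing_inj (k m : nat) (f : 'I_k -> 'I_m) :
  increasing f -> injective f.
Proof.
move=> incf i j fij; case: (ltngtP i j) => [/incf|/incf|/ord_inj //];
  by rewrite fij ltnn.
Qed.

Lemma increasing_leq (k m : nat) (f : 'I_k -> 'I_m) : increasing f -> k <= m.
Proof. by move/increasing_inj/leq_card; rewrite !card_ord. Qed.

Lemma enum_ord_sorted (q : nat) : sorted (fun i j : 'I_q => i < j) (enum 'I_q).
Proof.
have := iota_ltn_sorted 0 q; rewrite -val_enum_ord sorted_map.
by apply: sub_sorted.
Qed.

Lemma increasing_codom_subseq (k m : nat) (f : 'I_k -> 'I_m) :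
  increasing f -> subseq (codom f) (enum 'I_m).
Proof.
move=> incf; suff -> : codom f = [seq i <- enum 'I_m | i \in codom f].
  exact: filter_subseq.
have trans : transitive (fun i j : 'I_m => i < j) by move=> j i l; apply: ltn_trans.
apply: (irr_sorted_eq trans).
- by move=> i; rewrite /= ltnn.
- rewrite sorted_map; apply: sub_sorted (enum_ord_sorted k) => i j; exact: incf.
- by rewrite sorted_filter // enum_ord_sorted.
- by move=> i; rewrite mem_filter mem_enum andbT.
Qed.

Section PartiteConstruction.
Variable r : nat.

(* [pedge] is only meaningful on tuples whose projection is increasing. *)
Record partite (N : nat) := Partite {
  pvert :> finType;
  pproj : pvert -> 'I_N;
  pedge : ('I_r -> pvert) -> Prop }.

(** Nonedges are preserved too, because copies must be induced. Only tuples with increasing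
    projection matter, and there the projection already separates the vertices. *)
Definition pmorphism (N : nat) (P Q : partite N) (f : P -> Q) : Prop :=
  (forall v, pproj (f v) = pproj v) /\
  forall x : 'I_r -> P, increasing (@pproj _ P \o x) ->
    (pedge (f \o x) <-> pedge x).

Lemma pmorphism_comp (N : nat) (P Q S : partite N) (f : P -> Q) (g : Q -> S) :
  pmorphism f -> pmorphism g -> pmorphism (g \o f).
Proof.
move=> [pf ef] [pg eg]; split=> [v|x incx]; first by rewrite /= pg pf.
have incfx : increasing (@pproj _ Q \o (f \o x)).
  by move=> i j ij; rewrite /= !pf; apply: incx.
by rewrite -(ef _ incx) -(eg _ incfx).
Qed.

Definition pcopy (N s : nat) (P : partite N) (F : ('I_r -> 'I_s) -> Prop)
    (e : 'I_s -> 'I_N) (u : 'I_s -> P) : Prop :=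
  (forall i, pproj (u i) = e i) /\
  forall x : 'I_r -> 'I_s, increasing x -> (pedge (u \o x) <-> F x).

Section Step.
Variables (N s : nat) (P : partite N) (F : ('I_r -> 'I_s) -> Prop).
Variables (e : 'I_s -> 'I_N) (I : finType).
Hypothesis e_incr : increasing e.

Let word := {ffun 'I_s -> P}.
Let line := {ffun I -> option word}.
(** A letter is a candidate copy of the pattern. Over the range of [e] a vertex is an index with a
    word of vertices of [P]; for the other vertices each line owns a separate copy of [P], as in a
    free amalgam over the words. *)
Let vert : finType := ('I_s * {ffun I -> P} + line * P)%type.

Definition power_emb (l : line) (v : P) : vert :=
  if [pick i | e i == pproj v] is Some i
  then inl (i, [ffun t => if l t is Some w then w i else v])
  else inr (l, v).

(* Over an edge of the pattern [F] a tuple of the power is an edge iff all its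
   coordinates are, over a non-edge iff some coordinate is: in both cases the
   coordinates where a line is constant are irrelevant. *)
Definition power_edge (z : 'I_r -> vert) : Prop :=
  (exists (i : 'I_r -> 'I_s) (y : 'I_r -> {ffun I -> P}),
     [/\ forall j, z j = inl (i j, y j),
         F i -> forall t, pedge (fun j => y j t)
       & ~ F i -> exists t, pedge (fun j => y j t)]) \/
  (exists j q, z j = inr q) /\
  exists (l : line) (x : 'I_r -> P),
    [/\ exists t, l t = None, forall j, z j = power_emb l (x j) & pedge x].

Definition power_proj (v : vert) : 'I_N :=
  match v with inl p => e p.1 | inr q => pproj q.2 end.

Definition power : partite N := Partite power_proj power_edge.

Lemma power_emb_proj l v : power_proj (power_emb l v) = pproj v.
Proof. by rewrite /power_emb; case: pickP => [i /eqP|]. Qed.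

Lemma power_emb_inj (l : line) : (exists t, l t = None) ->
  injective (power_emb l).
Proof.
move=> [t lt] v v'; rewrite /power_emb.
case: pickP => [i _|_]; case: pickP => [i' _|_] // [] //.
by move=> _ /ffunP /(_ t); rewrite !ffunE lt.
Qed.

Lemma power_embE l v i : pproj v = e i ->
  power_emb l v = inl (i, [ffun t => if l t is Some w then w i else v]).
Proof.
move=> pv; rewrite /power_emb; case: pickP => [i' /eqP|/(_ i)].
  by rewrite pv => /(increasing_inj e_incr) ->.
by rewrite pv eqxx.
Qed.

(** At a moving coordinate the image of a tuple reads the tuple itself, at a constant one a copy of
    the pattern, which is an edge exactly over [F]; so the rule of [power_edge] returns the edges of
    [P]. A vertex off the range of [e] remembers its line, which excludes edges coming from another
    line. *)
Lemma power_emb_morphism (l : line) :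
  (exists t, l t = None) -> (forall t w, l t = Some w -> pcopy F e w) ->
  @pmorphism N P power (power_emb l).
Proof.
move=> l_moves l_copies; split=> [v|x incx]; first exact: power_emb_proj.
have [/choice[i xE]|] := pselect (forall j, exists i, pproj (x j) = e i).
  have inci : increasing i.
    move=> j k /incx /=; rewrite !xE; case: (ltngtP (i j) (i k)) => //.
      by move=> /e_incr /ltnW; rewrite leqNgt => /negPf ->.
    by move=> /ord_inj ->; rewrite ltnn.
  have coordE t : pedge (fun j => [ffun t => if l t is Some w then
      (w : word) (i j) else x j] t) <-> if l t is Some w then F i else pedge x.
    case E : (l t) => [w|].
      rewrite -((l_copies _ _ E).2 _ inci).
      rewrite (_ : (fun j => _) = w \o i) //.
      by apply/funext => j; rewrite ffunE E.
    rewrite (_ : (fun j => _) = x) //.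
    by apply/funext => j; rewrite ffunE E.
  split=> [[[i' [y [zE Ft Ff]]]|[[j [q]]]]|ex].
  - have yE j : i' j = i j /\
        y j = [ffun t => if l t is Some w then (w : word) (i j) else x j].
      by have := zE j; rewrite /= (power_embE _ (xE j)) => -[<- <-].
    have {}zE : i' = i by apply/funext => j; rewrite (yE j).1.
    subst i'; have yE' : y = fun j =>
        [ffun t => if l t is Some w then (w : word) (i j) else x j].
      by apply/funext => j; rewrite (yE j).2.
    rewrite yE' in Ft Ff; case: l_moves => t0 lt0.
    have [Fi|Fi] := pselect (F i).
      by have /coordE := Ft Fi t0; rewrite lt0.
    have [t /coordE] := Ff Fi; by case: (l t).
  - by rewrite /= (power_embE _ (xE j)).
  - left; exists i, (fun j =>
        [ffun t => if l t is Some w then (w : word) (i j) else x j]); split.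
    + by move=> j; rewrite /= (power_embE _ (xE j)).
    + by move=> Fi t; apply/coordE; case: (l t).
    + by move=> _; case: l_moves => t lt; exists t; apply/coordE; rewrite lt.
move=> /existsNP[j xjN].
have emb_j l' : power_emb l' (x j) = inr (l', x j).
  rewrite /power_emb; case: pickP => // i /eqP xj; case: xjN.
  by exists i.
split=> [[[i [y [/(_ j) /=]]]|]|ex]; first by rewrite emb_j.
  move=> [_ [l' [x' [_ zE ex']]]].
  have ll' : l' = l.
    have := zE j; rewrite /= emb_j /power_emb; case: pickP => // _.
    by move=> [-> _].
  subst l'; suff -> : x = x' by [].
  by apply/funext => k; apply: (power_emb_inj l_moves); rewrite -zE.
right; split; first by exists j, (l, x j); rewrite /= emb_j.
by exists l, x.
Qed.

End Step.

Lemma partite_lemma (N s : nat) (P : partite N) (F : ('I_r -> 'I_s) -> Prop)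
    (e : 'I_s -> 'I_N) (K : finType) : increasing e ->
  exists Q : partite N, forall X : ('I_s -> Q) -> K, exists f : P -> Q,
    pmorphism f /\
    forall u u', pcopy F e u -> pcopy F e u' -> X (f \o u) = X (f \o u').
Proof.
move=> e_incr.
pose copies := [seq w : {ffun 'I_s -> P} <- enum {ffun 'I_s -> P} |
  `[< pcopy F e w >] ].
have copiesP w : w \in copies <-> pcopy F e w.
  by rewrite mem_filter mem_enum andbT; split=> /asboolP.
have [I HI] := hales_jewett copies K.
exists (power P F e I) => X.
(* The image of a copy [u] under [power_emb l] is the point of [l] at the letter [u], so a
   monochromatic line gives all these images one colour. *)
have [l [[l_moves l_in] lX]] := HI (fun w => X (fun i : 'I_s =>
  inl (i, [ffun t => (w t : {ffun 'I_s -> P}) i]))).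
exists (power_emb e l); split.
  apply: (power_emb_morphism e_incr l_moves) => t w /l_in.
  by rewrite copiesP.
have key u : pcopy F e u -> exists2 w, w \in copies &
    X (power_emb e l \o u) = X (fun i : 'I_s =>
      inl (i, [ffun t => (line_point l w t : {ffun 'I_s -> P}) i])).
  move=> cu; exists [ffun i => u i].
    apply/copiesP; rewrite (_ : fun_of_fin _ = u) //.
    by apply/funext => i; rewrite ffunE.
  congr X; apply/funext => i; rewrite /= (power_embE e_incr _ (cu.1 i)).
  congr (inl (_, _)); apply/ffunP => t; rewrite !ffunE.
  by case: (l t) => //=; rewrite ffunE.
by move=> u u' /key[w win ->] /key[w' w'in ->]; apply: lX.
Qed.

(** Patterns are stored as finite sets of functions so that all tasks can be listed. The colouring
    of the last host is pulled back along [g] to serve the remaining tasks, and morphisms carry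
    copies to copies, so both gains combine. *)
Lemma partite_iterated (N a : nat) (P : partite N) (K : nat -> finType)
    (tasks : seq {s : 'I_a & ({set {ffun 'I_r -> 'I_s}} * {ffun 'I_s -> 'I_N})%type}) :
  exists Q : partite N, forall X : forall s, ('I_s -> Q) -> K s,
  exists f : P -> Q, pmorphism f /\
    forall p, p \in tasks -> increasing (tagged p).2 ->
    forall u u', let F := fun x : 'I_r -> 'I_(tag p) => finfun x \in (tagged p).1 in
      pcopy F (tagged p).2 u -> pcopy F (tagged p).2 u' ->
      X (tag p) (f \o u) = X (tag p) (f \o u').
Proof.
elim: tasks => [|p ps [Q HQ]].
  exists P => X; exists id; split=> //.
have [p_incr|p_nincr] := pselect (increasing (tagged p).2); last first.
  exists Q => X; have [f [fm fX]] := HQ X; exists f; split=> // q.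
  by rewrite in_cons => /orP[/eqP -> //|]; apply: fX.
have [Q' HQ'] := partite_lemma Q
  (fun x : 'I_r -> 'I_(tag p) => finfun x \in (tagged p).1) (K (tag p)) p_incr.
exists Q' => X; have [g [gm gX]] := HQ' (X (tag p)).
have [f [fm fX]] := HQ (fun s u => X s (g \o u)).
exists (g \o f); split; first exact: pmorphism_comp fm gm.
move=> q; rewrite in_cons => /orP[/eqP ->|/fX qX] q_incr u u' F cu cu'.
  have comp_copy w : pcopy F (tagged p).2 w -> pcopy F (tagged p).2 (f \o w).
    move=> [pw ew]; split=> [i|x incx]; first by rewrite /= fm.1 pw.
    rewrite -(ew _ incx); apply: (fm.2 (w \o x)).
    by move=> i j ij; rewrite /= !pw; apply: p_incr; apply: incx.
  by apply: gX; apply: comp_copy.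
exact: qX.
Qed.

(* Ramsey theorem for finite ordered hypergraphs (Nesetril and Rodl). The host
   [V] is not ordered: the relevant tuples are those of the copy [e]. *)
Theorem structural_ramsey (a : nat) (EA : ('I_r -> 'I_a) -> Prop)
    (K : nat -> finType) :
  exists (V : finType) (E : ('I_r -> V) -> Prop),
  forall X : forall s, ('I_s -> V) -> K s, exists e : 'I_a -> V,
    (forall x : 'I_r -> 'I_a, increasing x -> (E (e \o x) <-> EA x)) /\
    forall s (u u' : 'I_s -> 'I_a), increasing u -> increasing u' ->
      (forall x : 'I_r -> 'I_s, increasing x -> (EA (u \o x) <-> EA (u' \o x))) ->
      X s (e \o u) = X s (e \o u').
Proof.
pose K' s : finType := {ffun {set {ffun 'I_r -> 'I_s}} -> option (K s)}.
have [N HN] := ramsey_upto K' a.+1 a.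
(* One disjoint copy of [EA] over every map from ['I_a] to ['I_N]: whichever a columns Ramsey's
   theorem selects, a copy already sits over them. *)
pose P0 := @Partite N ({ffun 'I_a -> 'I_N} * 'I_a)%type (fun p => p.1 p.2)
  (fun z => exists e x, (forall j, z j = (e, x j)) /\ EA x).
pose task := {s : 'I_a.+1 &
  ({set {ffun 'I_r -> 'I_s}} * {ffun 'I_s -> 'I_N})%type}.
have [Q HQ] := partite_iterated P0 K (enum (task : finType)).
exists Q, (@pedge _ Q) => X.
have [f [fm fX]] := HQ X.
pose setF s (F : {set {ffun 'I_r -> 'I_s}}) := fun x : 'I_r -> 'I_s => finfun x \in F.
have {}fX s (F : {set {ffun 'I_r -> 'I_s}}) (u u' : 'I_s -> P0) : s < a.+1 ->
    increasing (@pproj _ P0 \o u) -> @pproj _ P0 \o u = @pproj _ P0 \o u' ->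
    pcopy (setF s F) (@pproj _ P0 \o u) u ->
    pcopy (setF s F) (@pproj _ P0 \o u') u' -> X s (f \o u) = X s (f \o u').
  move=> lt_s incu uu'; rewrite -uu' => cu cu'.
  pose p : task := existT _ (Ordinal lt_s) (F, finfun (@pproj _ P0 \o u)).
  have pE : (tagged p).2 = @pproj _ P0 \o u :> (_ -> _).
    by apply/funext => i; rewrite /p /= ffunE.
  have /= := fX p _ _ u u'; rewrite mem_enum pE => /(_ isT incu cu cu').
  by [].
pose good s (F : {set {ffun 'I_r -> 'I_s}}) (l : seq 'I_N) (u : 'I_s -> P0) :=
  [/\ codom (@pproj _ P0 \o u) = l, increasing (@pproj _ P0 \o u)
    & pcopy (setF s F) (@pproj _ P0 \o u) u].
(* By [fX] the colour of a copy depends only on its pattern and its columns, so the choice of the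
   copy is immaterial and [col] is a colouring of sets of columns. *)
pose col s (l : seq 'I_N) : K' s := [ffun F =>
  if pselect (exists u, good s F l u) is left h
  then Some (X s (f \o projT1 (cid h))) else None].
have [|l [lN szl lX]] := HN 'I_N (enum 'I_N) col; first by rewrite size_enum_ord.
have szl' : size l == a by rewrite szl.
pose e := [ffun i => tnth (Tuple szl') i].
have e_incr : increasing e.
  move=> i j ij; have eE k : e k = nth (e i) l k by rewrite [LHS]ffunE (tnth_nth (e i)).
  rewrite (eE i) (eE j).
  have srt : sorted (fun i j : 'I_N => i < j) l.
    apply: (subseq_sorted _ lN); first by move=> ? ? ?; apply: ltn_trans.
    exact: enum_ord_sorted.
  apply: (sorted_ltn_nth _ _ srt) => //.
  - by move=> ? ? ?; apply: ltn_trans.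
  - by rewrite inE szl.
  - by rewrite inE szl.
have le_l s (u : 'I_s -> 'I_a) : increasing u -> subseq (codom (e \o u)) l.
  move=> incu; have -> : l = map e (enum 'I_a).
    rewrite -[LHS]/(tval (Tuple szl')) -[in LHS](map_tnth_enum (Tuple szl')).
    by apply: eq_map => i; rewrite ffunE.
  by rewrite codomE map_comp; apply: map_subseq; exact: increasing_codom_subseq.
exists (f \o pair e); split.
  move=> x incx; rewrite -[_ \o x]/(f \o (pair e \o x)) fm.2; last first.
    by move=> i j ij; apply: e_incr; apply: incx.
  split=> [[e' [x' [zE ex']]]|ex]; last by exists e, x.
  by rewrite (_ : x = x') //; apply/funext => j; have [] := zE j.
move=> s u u' incu incu' same.
have le_sa : s < a.+1 by rewrite ltnS; apply: increasing_leq incu.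
pose F : {set {ffun 'I_r -> 'I_s}} := 
    finset (fun x : {ffun 'I_r -> 'I_s} => `[< EA (u \o x) >]).
have goodF w : increasing w ->
    (forall x : 'I_r -> 'I_s, increasing x -> (EA (u \o x) <-> EA (w \o x))) ->
    good s F (codom (e \o w)) (pair e \o w).
  move=> incw samew; split=> //.
    by move=> i j ij; apply: e_incr; apply: incw.
  split=> // x incx; rewrite /setF inE.
  have -> : finfun x = x :> (_ -> _) by apply/funext => i; rewrite ffunE.
  split=> [[e' [x' [zE ex']]]|/asboolP /(samew _ incx) ex]; last first.
    by exists e, (w \o x).
  apply/asboolP/(samew _ incx).
  by rewrite (_ : w \o x = x') //; apply/funext => j; have [] := zE j.
have colE w : increasing w ->
    (forall x : 'I_r -> 'I_s, increasing x -> (EA (u \o x) <-> EA (w \o x))) ->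
    col s (codom (e \o w)) F = Some (X s (f \o (pair e \o w))).
  move=> incw samew; have gw := goodF w incw samew.
  rewrite ffunE; case: pselect => [h|[]]; last by eexists; exact: gw.
  case: cid => w' [cw' incw' copyw'] /=; case: gw => [cw incw1 copyw].
  congr Some; apply: (fX s F) => //; apply/funext => i.
  move: cw'; rewrite -cw !codomE => /eq_in_map /(_ i); apply.
  by rewrite mem_enum.
have := lX s (codom (e \o u)) (codom (e \o u')) le_sa (le_l _ _ incu) (le_l _ _ incu').
rewrite !size_codom !card_ord => /(_ erefl erefl) /ffunP /(_ F).
by rewrite !colE // => -[].
Qed.

End PartiteConstruction.

Local Open Scope classical_set_scope.
Local Open Scope ring_scope.

(** * Renaming of variables, finite support and boundedness of formulas *)

Section Substitution.
Variables (R : realType) (L : signature R).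

Fixpoint tmap (V W : Type) (g : V -> W) (t : term L V) : term L W :=
  match t with
  | Var v => Var (g v)
  | App f ts => App f (fun i => tmap g (ts i))
  end.

Fixpoint fmap (V : Type) (phi : formula L V) :
    forall W : Type, (V -> W) -> formula L W :=
  match phi with
  | Dist t1 t2 => fun W g => Dist (tmap g t1) (tmap g t2)
  | Pred p ts => fun W g => Pred (fun i => tmap g (ts i))
  | Conn k u cu phis => fun W g => Conn cu (fun i => fmap (phis i) g)
  | Sup psi => fun W g => Sup (fmap psi (omap g))
  | Inf psi => fun W g => Inf (fmap psi (omap g))
  end.

Lemma teval_map (M : mstructure L) V W (g : V -> W) t (s : W -> M) :
  teval s (tmap g t) = teval (s \o g) t.
Proof.
elim: t => [v|f ts IH] //=; congr finterp; apply/funext => i; exact: IH.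
Qed.

Lemma vcons_omap (M : mstructure L) V W (g : V -> W) (a : M) (s : W -> M) :
  vcons a s \o omap g = vcons a (s \o g).
Proof. by apply/funext => -[v|]. Qed.

Lemma feval_map (M : mstructure L) V (phi : formula L V) W (g : V -> W)
    (s : W -> M) :
  feval (fmap phi g) s = feval phi (s \o g).
Proof.
elim: phi W g s => {V} [V t1 t2|V p ts|V k u cu phis IH|V psi IH|V psi IH] W g s /=.
- by rewrite !teval_map.
- by congr pinterp; apply/funext => i; rewrite teval_map.
- by congr u; apply/rowP => i; rewrite !mxE IH.
- suff -> : (fun a => feval (fmap psi (omap g)) (vcons a s)) =
      (fun a => feval psi (vcons a (s \o g))) by [].
  by apply/funext => a; rewrite IH vcons_omap.
- suff -> : (fun a => feval (fmap psi (omap g)) (vcons a s)) =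
      (fun a => feval psi (vcons a (s \o g))) by [].
  by apply/funext => a; rewrite IH vcons_omap.
Qed.

Lemma tmap_comp U V W (g : U -> V) (h : V -> W) t :
  tmap h (tmap g t) = tmap (h \o g) t.
Proof. by elim: t => [v|f ts IH] //=; congr App; apply/funext => i. Qed.

Lemma fmap_comp U (phi : formula L U) V W (g : U -> V) (h : V -> W) :
  fmap (fmap phi g) h = fmap phi (h \o g).
Proof.
have omap_comp U' V' W' (g' : U' -> V') (h' : V' -> W') :
    omap h' \o omap g' = omap (h' \o g') by apply/funext => -[].
elim: phi V W g h => {U} [U t1 t2|U p ts|U k u cu phis IH|U psi IH|U psi IH] V W g h /=.
- by rewrite !tmap_comp.
- by congr Pred; apply/funext => i; rewrite tmap_comp.
- by congr Conn; apply/funext => i; rewrite IH.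
- by rewrite IH omap_comp.
- by rewrite IH omap_comp.
Qed.

Lemma term_finite_support V (t : term L V) :
  exists (F : finType) (t' : term L F) (g : F -> V), t = tmap g t'.
Proof.
elim: t => [v|f ts IH].
  by exists unit, (Var tt), (fun=> v).
have /choice[h hE] : forall i, exists p : {F : finType & (term L F * (F -> V))%type},
    ts i = tmap (projT2 p).2 (projT2 p).1.
  by move=> i; have [F [t' [g E]]] := IH i; exists (existT _ F (t', g)).
exists {i : 'I_(fun_arity f) & projT1 (h i)},
  (App f (fun i => tmap (existT _ i) (projT2 (h i)).1)),
  (fun q => (projT2 (h (tag q))).2 (tagged q)) => /=.
by congr App; apply/funext => i; rewrite tmap_comp.
Qed.

(** The delicate case is a quantifier: the support of its body may contain several names for the
    bound variable. All names sent to [None] are merged into it, and the others stay free. *)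
Lemma formula_finite_support V (phi : formula L V) :
  exists (F : finType) (phi' : formula L F) (g : F -> V), phi = fmap phi' g.
Proof.
have unquant (W : Type) (psi : formula L (option W)) (F : finType)
    (psi' : formula L F) (g : F -> option W) : psi = fmap psi' g ->
  exists (F' : finType) (psi'' : formula L (option F')) (g' : F' -> W),
    psi = fmap psi'' (omap g').
  move=> ->.
  have /choice[g' g'E] : forall x : {f : F | g f : bool}, exists w,
      g (val x) = Some w.
    by move=> [f gf] /=; case: (g f) gf => // w _; exists w.
  exists {f : F | g f : bool}, (fmap psi' insub), g'.
  rewrite fmap_comp; congr fmap; apply/funext => f /=.
  by case: insubP => [x _ <- /=|]; [rewrite -g'E|case: (g f)].
elim: phi => {V} [V t1 t2|V p ts|V k u cu phis IH|V psi IH|V psi IH].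
- have [F1 [t1' [g1 E1]]] := term_finite_support t1.
  have [F2 [t2' [g2 E2]]] := term_finite_support t2.
  exists (F1 + F2)%type, (Dist (tmap inl t1') (tmap inr t2')),
    (fun x => match x with inl y => g1 y | inr y => g2 y end) => /=.
  by rewrite !tmap_comp E1 E2.
- have /choice[h hE] : forall i, exists p : {F : finType & (term L F * (F -> V))%type},
      ts i = tmap (projT2 p).2 (projT2 p).1.
    move=> i; have [F [t' [g E]]] := term_finite_support (ts i).
    by exists (existT _ F (t', g)).
  exists {i : 'I_(pred_arity p) & projT1 (h i)},
    (Pred (fun i => tmap (existT _ i) (projT2 (h i)).1)),
    (fun q => (projT2 (h (tag q))).2 (tagged q)) => /=.
  by congr Pred; apply/funext => i; rewrite tmap_comp.
- have /choice[h hE] : forall i,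
      exists p : {F : finType & (formula L F * (F -> V))%type},
      phis i = fmap (projT2 p).1 (projT2 p).2.
    by move=> i; have [F [t' [g E]]] := IH i; exists (existT _ F (t', g)).
  exists {i : 'I_k & projT1 (h i)},
    (Conn cu (fun i => fmap (projT2 (h i)).1 (existT _ i))),
    (fun q => (projT2 (h (tag q))).2 (tagged q)) => /=.
  by congr Conn; apply/funext => i; rewrite fmap_comp.
- have [F [psi' [g /unquant[F' [psi'' [g' E]]]]]] := IH.
  by exists F', (Sup psi''), g'; rewrite E.
- have [F [psi' [g /unquant[F' [psi'' [g' E]]]]]] := IH.
  by exists F', (Inf psi''), g'; rewrite E.
Qed.

(** A continuous connective is bounded on a compact box containing its arguments. Boundedness makes
    [sup] and [inf] genuine bounds, provides ultralimits of values, and allows rounding to finitely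
    many colours. *)
Lemma feval_bounded (M : mstructure L) V (phi : formula L V) :
  exists B : R, forall s : V -> M, `|feval phi s| <= B.
Proof.
have [x0] := minhabited M.
elim: phi => {V} [V t1 t2|V p ts|V k u cu phis IH|V psi [B IH]|V psi [B IH]].
- exists (diam L) => s /=; rewrite ger0_norm; last exact: mdist_ge0.
  exact: mdiam.
- exists (`|plow p| + `|phigh p|) => s /=.
  have /andP[lo hi] := pinterp_itv (fun i => teval s (ts i)).
  rewrite ler_norml; apply/andP; split.
    apply: le_trans lo; rewrite opprD; apply: le_trans (lerNnormlW _); last first.
      exact: lexx.
    by rewrite gerBl.
  by apply: (le_trans hi); apply: le_trans (ler_norm _) _; rewrite lerDr.
- have /choice[B HB] : forall i, exists B : R, forall s : V -> M,
      `|feval (phis i) s| <= B := IH.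
  pose A := [set v : 'rV[R]_k | forall i, `[- B i, B i]%classic (v ord0 i)].
  have cA : compact A.
    apply: (@rV_compact R k (fun i => `[- B i, B i]%classic)) => i.
    exact: segment_compact.
  have cuA : compact (u @` A).
    by apply: continuous_compact => //; apply: continuous_subspaceT.
  have [B' [_ HB']] := compact_bounded cuA.
  exists (B' + 1) => s /=; apply: (HB' (B' + 1)); first by rewrite ltrDl.
  exists (\row_i feval (phis i) s) => // i.
  by rewrite /= in_itv /= mxE -ler_norml.
- exists B => s /=; rewrite ler_norml; apply/andP; split.
    apply: (@le_trans _ _ (feval psi (vcons x0 s))).
      by have := IH (vcons x0 s); rewrite ler_norml => /andP[].
    apply: sup_ubound; last by exists x0.
    exists B => _ [a _ <-]; apply: le_trans (IH (vcons a s)); exact: ler_norm.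
  apply: sup_le_ub; first by exists (feval psi (vcons x0 s)), x0.
  move=> _ [a _ <-]; apply: le_trans (IH (vcons a s)); exact: ler_norm.
- exists B => s /=; rewrite ler_norml; apply/andP; split.
    apply: lb_le_inf; first by exists (feval psi (vcons x0 s)), x0.
    by move=> _ [a _ <-]; have := IH (vcons a s); rewrite ler_norml => /andP[].
  apply: (@le_trans _ _ (feval psi (vcons x0 s))); last first.
    apply: le_trans (IH (vcons x0 s)); exact: ler_norm.
  apply: ge_inf; last by exists x0.
  exists (- B) => _ [a _ <-].
  by have := IH (vcons a s); rewrite ler_norml => /andP[].
Qed.

End Substitution.

(** * Ultralimits of tuples in a saturated structure *)

Lemma ultra_cvg_bounded (R : realType) (T : Type) (U : set_system T)
    (f : T -> R) (B : R) :
  UltraFilter U -> (forall t, `|f t| <= B) -> exists v : R, f @ U --> v.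
Proof.
move=> UU fB; have PU : ProperFilter U := ultra_proper.
have [v [_ vcl]] : exists v, (`[- B, B]%classic `&` cluster (f @ U)) v.
  apply: segment_compact; suff : U (f @^-1` `[- B, B]%classic) by [].
  apply: filterE => t /=.
  by rewrite in_itv /= -ler_norml; exact: fB.
exists v => A vA; have [//|UnA] := in_ultra_setVsetC (f @^-1` A) UU.
have UnA' : (f @ U) (~` A) by [].
by have [x []] := vcl _ _ UnA' vA.
Qed.

Section Realization.
Variables (R : realType) (L : signature R).

Lemma coord_sub_norm k (i : 'I_k) (v : R) :
  continuous (fun x : 'rV[R]_k => `|x ord0 i - v|).
Proof.
move=> x.
have c0 : continuous (fun y : 'rV[R]_k => y ord0 i) by exact: coord_continuous.
have cx : {for x, continuous (fun y : 'rV[R]_k => y ord0 i - v)}.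
  have cv : continuous (fun _ : 'rV[R]_k => v) by exact: cst_continuous.
  exact: (continuousB (c0 x) (cv x)).
have H := continuous_comp cx (@norm_continuous _ R _).
exact: H.
Qed.

Lemma dev_continuous (v : R) :
  continuous (fun x : 'rV[R]_2 => `|x ord0 ord0 - v| + x ord0 ord_max).
Proof.
have c0 : continuous (fun y : 'rV[R]_2 => y ord0 ord_max).
  exact: coord_continuous.
move=> x; exact: (continuousD (@coord_sub_norm 2 ord0 v x) (c0 x)).
Qed.

(** Deviations from finitely many target values are added up into one formula, so that a single
    infimum controls them all. *)
Definition dev V (phi : formula L V) (v : R) (theta : formula L V) : formula L V :=
  Conn (@dev_continuous v) (fun i : 'I_2 => if i == ord0 then phi else theta).

Lemma feval_dev (M : mstructure L) V (phi : formula L V) v theta (s : V -> M) :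
  feval (dev phi v theta) s = `|feval phi s - v| + feval theta s.
Proof. by rewrite /= !mxE. Qed.

Lemma excess_continuous (v e : R) :
  continuous (fun x : 'rV[R]_1 => Num.max (`|x ord0 ord0 - v| - e) 0).
Proof.
have c1 : continuous (fun x : 'rV[R]_1 => `|x ord0 ord0 - v| - e).
  have ce : continuous (fun _ : 'rV[R]_1 => e) by exact: cst_continuous.
  move=> x; exact: (continuousB (@coord_sub_norm 1 ord0 v x) (ce x)).
have c2 : continuous (fun _ : 'rV[R]_1 => 0 : R) by exact: cst_continuous.
exact: (max_fun_continuous c1 c2).
Qed.

(** Turns an inequality into a condition of the form phi = 0, the one that [saturated] handles. *)
Definition excess V (phi : formula L V) (v e : R) : formula L V :=
  Conn (@excess_continuous v e) (fun=> phi).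

Lemma feval_excess (M : mstructure L) V (phi : formula L V) v e (s : V -> M) :
  feval (excess phi v e) s = 0 <-> `|feval phi s - v| <= e.
Proof.
rewrite /= !mxE -subr_le0; split=> [<-|/max_r //].
by rewrite le_max lexx.
Qed.

Lemma zero_continuous : continuous (fun _ : 'rV[R]_0 => 0 : R).
Proof. exact: cst_continuous. Qed.

Definition fzero V : formula L V :=
  Conn (@zero_continuous) (fun i : 'I_0 => match notF (ltn_ord i) with end).

Lemma feval_inf_le (M : mstructure L) V (psi : formula L (option V))
    (s : V -> M) (x : M) : feval (Inf psi) s <= feval psi (vcons x s).
Proof.
have [B HB] := feval_bounded M psi; apply: ge_inf; last by exists x.
exists (- B) => _ [a _ <-].
by have := HB (vcons a s); rewrite ler_norml => /andP[].
Qed.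

Lemma feval_inf_lt (M : mstructure L) V (psi : formula L (option V))
    (s : V -> M) (d : R) : feval (Inf psi) s < d ->
  exists x : M, feval psi (vcons x s) < d.
Proof.
move=> /inf_lt[|_ [x _ <-] xd]; last by exists x.
by have [x0] := minhabited M; exists (feval psi (vcons x0 s)), x0.
Qed.

Variables (K : Type) (M : mstructure L).
Hypotheses (K_nat : small K nat) (M_sat : saturated K M).

Lemma small_countable (X : Type) : countable [set: X] -> small K X.
Proof. by move=> cX KX; apply: K_nat; exact: card_le_trans KX cX. Qed.

Variables (T : Type) (U : set_system T) (tau : T -> nat -> M).
Hypothesis U_ultra : UltraFilter U.

Definition limit_upto (m : nat) (s : nat -> M) : Prop :=
  forall phi : formula L 'I_m,
    (fun t => feval phi (tau t \o val)) @ U --> feval phi (s \o val).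

Definition update (s : nat -> M) (m : nat) (x : M) (i : nat) : M :=
  if i == m then x else s i.

(** Saturation is applied to the conditions |phi - v| <= e over the points already found, v being
    the limit of phi. An infimum need not be attained, hence the slack e > 0: along [U] the infimum
    of a finite sum of deviations tends to 0, and by [limit_upto] so small an infimum is also found
    at [s], which yields finite satisfiability. *)
Lemma limit_step (m : nat) (s : nat -> M) :
  limit_upto m s -> exists x, limit_upto m.+1 (update s m x).
Proof.
move=> slim; have PU : ProperFilter U := ultra_proper.
pose A : set M := [set s i | i in `I_m].
have A_small : small K A.
  apply: small_countable; rewrite (eq_countable (card_setT _)).
  exact/finite_set_countable/finite_image/finite_II.
have /choice[rho rhoE] : forall i : 'I_m.+1, exists z : 'I_1 + A,
    forall b : 'I_1 -> M,
    match z with inl i => b i | inr a => set_val a end = update s m (b ord0) i.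
  move=> i; rewrite /update; have [im|im] := eqVneq (i : nat) m.
    by exists (inl ord0) => b.
  have iA : A (s i).
    by exists i => //=; rewrite ltn_neqAle im -ltnS ltn_ord.
  by exists (inr (exist _ (s i) (mem_set iA))) => b.
pose lim_is (phi : formula L 'I_m.+1) (v : R) :=
  (fun t => feval phi (tau t \o val)) @ U --> v.
pose Gamma : set (formula L ('I_1 + A)) := [set psi |
  exists phi v e, [/\ lim_is phi v, 0 < e & psi = fmap (excess phi v e) rho]].
have evalE (phi : formula L 'I_m.+1) (b : 'I_1 -> M) :
    feval (fmap phi rho) (fun v => match v with
      | inl i => b i | inr a => set_val a end) =
    feval phi (update s m (b ord0) \o val).
  by rewrite feval_map; congr feval; apply/funext => i; exact: rhoE.
have approx (theta : formula L 'I_m.+1) d : lim_is theta 0 -> 0 < d ->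
    exists x, feval theta (update s m x \o val) < d.
  move=> theta0 d0.
  pose sigma (i : 'I_m.+1) : option 'I_m := insub (i : nat).
  have sigmaE x (s' : nat -> M) :
      vcons x (s' \o val) \o sigma = update s' m x \o val.
    apply/funext => i; rewrite /= /sigma /update /vcons.
    case: insubP => [j _ /= <-|].
      by rewrite ltn_eqF.
    by rewrite -leqNgt => mi; rewrite eqn_leq mi -ltnS ltn_ord.
  suff /feval_inf_lt[x] : feval (Inf (fmap theta sigma)) (s \o val) < d.
    by rewrite feval_map sigmaE; exists x.
  apply: (@le_lt_trans _ _ (d / 2)); last first.
    by rewrite ltr_pdivrMr // ltr_pMr // ltr1n.
  apply: (closed_cvg (fun y => y <= d / 2) _ _ _
    (slim (Inf (fmap theta sigma)))).
    exact: closed_le.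
  have /cvgrPdist_lt /(_ (d / 2)) := theta0.
  rewrite divr_gt0 // => /(_ isT); apply: filterS => t.
  rewrite sub0r normrN => /ltW le_d.
  (* The next coordinate of [tau t] itself competes in the infimum. *)
  apply: le_trans (feval_inf_le _ _ (tau t m)) _.
  rewrite feval_map sigmaE (_ : update _ _ _ = tau t); last first.
    by apply/funext => i; rewrite /update; case: eqP => [->|].
  by apply: le_trans le_d; exact: ler_norm.
have [b bG] : exists b, satisfies Gamma b.
  apply: M_sat => // Delta Delta_fin Delta_sub.
  have [l Delta_l] : exists l : seq {classic formula L ('I_1 + A)},
      Delta `<=` [set` l].
    have /finite_seqP[l ->] := Delta_fin : @finite_set {classic _} Delta.
    by exists l.
  have [theta [d [theta0 theta_ge0 d0 thetaG]]] :
      exists theta d, [/\ lim_is theta 0,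
        forall s : nat -> M, 0 <= feval theta (s \o val), 0 < d &
        forall b : 'I_1 -> M, feval theta (update s m (b ord0) \o val) < d ->
        forall psi, psi \in l -> Gamma psi ->
          feval psi (fun v => match v with
            | inl i => b i | inr a => set_val a end) = 0].
    elim: l {Delta_l} => [|psi l [theta [d [theta0 theta_ge0 d0 thetaG]]]].
      by exists (fzero _), 1; split => //; exact: cvg_cst.
    have [[phi [v [e [phiv e0 psiE]]]]|nG] := pselect (Gamma psi); last first.
      exists theta, d; split=> // b bd psi'.
      by rewrite in_cons => /orP[/eqP -> //|]; exact: thetaG.
    exists (dev phi v theta), (Num.min d e); split.
    - rewrite /lim_is; under eq_fun do rewrite feval_dev.
      have -> : 0 = `|v - v| + 0 :> R by rewrite subrr normr0 addr0.
      by apply: cvgD => //; apply: cvg_norm; apply: cvgB => //; exact: cvg_cst.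
    - by move=> s'; rewrite feval_dev addr_ge0.
    - by rewrite lt_min d0.
    - move=> b; rewrite feval_dev lt_min => /andP[bd be] psi'.
      rewrite in_cons => /orP[/eqP -> _|]; last first.
        by apply: thetaG; apply: le_lt_trans bd; rewrite lerDr.
      rewrite psiE evalE; apply/feval_excess; apply: ltW.
      by apply: le_lt_trans be; rewrite lerDl.
  have [x xd] := approx theta d theta0 d0.
  exists (fun=> x) => psi Dpsi.
  apply: (thetaG (fun=> x)) => //; [exact: (Delta_l _ Dpsi)|exact: Delta_sub].
exists (b ord0) => phi.
have [B HB] := feval_bounded M phi.
have [v phiv] : exists v : R, lim_is phi v.
  by apply: (@ultra_cvg_bounded _ _ _ _ B).
suff -> : feval phi (update s m (b ord0) \o val) = v by [].
apply/eqP; rewrite -subr_eq0 -normr_le0; apply/ler_addgt0Pl => e e0.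
rewrite addr0; apply/feval_excess; rewrite -evalE; apply: bG.
by exists phi, v, e.
Qed.

Lemma limit_all : exists s : nat -> M, forall m, limit_upto m s.
Proof.
have PU : ProperFilter U := ultra_proper.
have [x0] := minhabited M.
have /choice[X XP] : forall p : nat * (nat -> M), exists x,
    limit_upto p.1 p.2 -> limit_upto p.1.+1 (update p.2 p.1 x).
  move=> [m s] /=; have [/limit_step[x xP]|nl] := pselect (limit_upto m s).
    by exists x.
  by exists x0.
pose S := fix S k := if k is k'.+1 then update (S k') k' (X (k', S k'))
  else (fun=> x0).
have S_lim k : limit_upto k (S k).
  elim: k => [|k IH]; last exact: (XP (k, S k) IH).
  (* Without free variables the values along [U] are constant, since all tuples live in the same
     structure. *)
  move=> phi; have E t : tau t \o val = (fun=> x0) \o val :> ('I_0 -> M).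
    by apply/funext => -[].
  by under eq_fun do rewrite E; exact: cvg_cst.
have S_stable i d : S (i.+1 + d)%N i = S i.+1 i.
  elim: d => [|d IH]; first by rewrite addn0.
  rewrite -{}IH addnS /= {1}/update ifN // ltn_eqF //.
  by rewrite addSn ltnS leq_addr.
exists (fun i => S i.+1 i) => m phi.
suff -> : (fun i => S i.+1 i) \o val = S m \o val :> ('I_m -> M) by exact: S_lim.
apply/funext => i; rewrite -[LHS]/(S i.+1 i) -(S_stable i (m - i.+1)%N).
by rewrite subnKC.
Qed.

End Realization.

(* Countable saturation, phrased with ultralimits. *)
Theorem ultralimit_realized (R : realType) (L : signature R) (K : Type)
    (M : mstructure L) (T V : Type) (U : set_system T) (tau : T -> V -> M)
    (code : V -> nat) :
  small K nat -> saturated K M -> UltraFilter U -> injective code ->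
  exists s : V -> M, forall (F : finType) (g : F -> V) (phi : formula L F),
    (fun t => feval phi (tau t \o g)) @ U --> feval phi (s \o g).
Proof.
move=> K_nat M_sat U_ultra code_inj; have [x0] := minhabited M.
pose tau' t i := if pselect (exists v, code v = i) is left h
  then tau t (projT1 (cid h)) else x0.
have tau'E t v : tau' t (code v) = tau t v.
  rewrite /tau'; case: pselect => [h|[]]; last by exists v.
  by case: cid => w /= /code_inj ->.
have [s sP] := limit_all K_nat M_sat tau' U_ultra.
exists (s \o code) => F g phi.
pose m := (\max_(f : F) code (g f)).+1.
have gm f : (code (g f) < m)%N by rewrite ltnS; apply: leq_bigmax.
pose h (f : F) : 'I_m := Ordinal (gm f).
have := sP m (fmap phi h); rewrite feval_map.
have -> : (fun t => feval (fmap phi h) (tau' t \o val)) =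
    (fun t => feval phi (tau t \o g)).
  apply/funext => t; rewrite feval_map; congr feval; apply/funext => f.
  exact: tau'E.
by [].
Qed.

(** * Countable structures embed into Fraisse limits *)

Section FraisseLimits.
Variable L : rlang.

Definition embedding_on (H G : rstruct L) (D : set H) (f : H -> G) : Prop :=
  (forall x y, D x -> D y -> f x = f y -> x = y) /\
  forall (s : rsym L) (x : 'I_(rarity s) -> H), (forall i, D (x i)) ->
    (rinterp (f \o x) <-> rinterp x).

Lemma fraisse_limit_local (C : rstruct L -> Prop) (G : rstruct L) :
  fraisse_limit C G -> forall D : set G, finite_set D -> C (rsub D).
Proof.
move=> [_ _ ageE] D Dfin; apply/ageE; split.
  by rewrite /rfinite (eq_finite_set (card_setT _)).
by exists (fun x : rsub D => set_val x); split=> // x y /val_inj.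
Qed.

Variables (C : rstruct L -> Prop) (G H : rstruct L).
Hypothesis G_limit : fraisse_limit C G.
Hypothesis H_local : forall D : set H, finite_set D -> C (rsub D).

Lemma embedding_on_finite (D : set H) : finite_set D -> inhabited G ->
  exists f : H -> G, embedding_on D f.
Proof.
move=> Dfin [g0]; have [_ _ ageE] := G_limit.
have [_ [f [f_inj f_rel]]] := (ageE _).2 (H_local Dfin).
pose f' x := if pselect (D x) is left h then f (exist _ x (mem_set h)) else g0.
have f'E x (Dx : D x) : f' x = f (exist _ x (mem_set Dx)).
  rewrite /f'; case: pselect => // h.
  by rewrite (Prop_irrelevance h Dx).
exists f'; split=> [x y Dx Dy|s x Dx].
  by rewrite (f'E _ Dx) (f'E _ Dy) => /f_inj [].
rewrite (_ : f' \o x = f \o (fun i => exist _ (x i) (mem_set (Dx i)))).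
  exact: f_rel.
by apply/funext => i /=; exact: f'E.
Qed.

(** [D'] is embedded anew by [g], which is then corrected by an automorphism extending the finite
    isomorphism from g(D) to f(D). *)
Lemma embedding_on_extend (D D' : set H) (f : H -> G) :
  finite_set D' -> D `<=` D' -> inhabited G -> embedding_on D f ->
  exists2 f' : H -> G, embedding_on D' f' & forall x, D x -> f' x = f x.
Proof.
move=> D'fin DD' G0 [f_inj f_rel].
have Dfin : finite_set D := sub_finite_set DD' D'fin.
have [_ homog _] := G_limit.
have [g [g_inj g_rel]] := embedding_on_finite D'fin G0.
pose A := g @` D; pose B := f @` D.
have /choice[phi phiE] : forall a : rsub A, exists b : rsub B,
    exists x, [/\ D x, g x = set_val a & f x = set_val b].
  move=> a; have [x Dx xa] := set_valP a.
  have Bx : B (f x) by exists x.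
  by exists (exist _ (f x) (mem_set Bx)), x.
have /choice[psi psiE] : forall b : rsub B, exists a : rsub A,
    exists x, [/\ D x, g x = set_val a & f x = set_val b].
  move=> b; have [x Dx xb] := set_valP b.
  have Ax : A (g x) by exists x.
  by exists (exist _ (g x) (mem_set Ax)), x.
have phi_inj : injective phi.
  move=> a a' aa'; have [x [Dx xa xb]] := phiE a; have [x' [Dx' xa' xb']] := phiE a'.
  apply: val_inj; rewrite -[LHS]xa -[RHS]xa'; congr g; apply: f_inj => //.
  by rewrite xb xb' aa'.
have [sigma [[sigma_inj sigma_rel] _] sigmaE] : exists2 s : G -> G,
    risomorphism s & forall x : rsub A, s (set_val x) = set_val (phi x).
  apply: homog; rewrite ?/A ?/B; [exact: finite_image..|].
  split; [split=> //|].
    move=> s x; have /choice[y yE] := fun i => phiE (x i).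
    have -> : rinterp x <-> rinterp (g \o y).
      rewrite /=; suff -> : (fun i => set_val (x i)) = g \o y by [].
      by apply/funext => i; case: (yE i).
    have -> : rinterp (phi \o x) <-> rinterp (f \o y).
      rewrite /=; suff -> : (fun i => set_val (phi (x i))) = f \o y by [].
      by apply/funext => i; case: (yE i).
    have yD i : D (y i) by case: (yE i).
    rewrite (f_rel _ _ yD) (g_rel s y) //.
    by move=> i; exact: DD'.
  exists psi.
    move=> a; apply: phi_inj; apply: val_inj.
    have [x [Dx xa xb]] := phiE (psi (phi a)); have [y [Dy ya yb]] := psiE (phi a).
    rewrite -[LHS]xb -[RHS]yb; congr f; apply: g_inj; rewrite ?xa ?ya //; exact: DD'.
  move=> b; apply: val_inj.
  have [x [Dx xa xb]] := phiE (psi b); have [y [Dy ya yb]] := psiE b.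
  rewrite -[LHS]xb -[RHS]yb; congr f; apply: g_inj; rewrite ?xa ?ya //; exact: DD'.
exists (sigma \o g); [split|].
- by move=> x y Dx Dy /sigma_inj; exact: g_inj.
- by move=> s x Dx; rewrite -(g_rel _ _ Dx); exact: sigma_rel.
- move=> x Dx; have Ax : A (g x) by exists x.
  pose a : rsub A := exist _ (g x) (mem_set Ax).
  have [y [Dy yx yb]] := phiE a.
  rewrite -[LHS]/(sigma (set_val a)) sigmaE -yb; congr f.
  by apply: g_inj => //; exact: DD'.
Qed.

Theorem fraisse_limit_universal :
  countable [set: H] -> exists f : H -> G, rembedding f.
Proof.
move=> /countable_injP[code code_inj'].
have code_inj : injective code by move=> x y; apply: code_inj'; rewrite in_setT.
(* The empty structure is set apart: [G] might then have no point to serve as a default value. *)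
have [[h0]|H0] := pselect (inhabited H); last first.
  have Tfin : finite_set [set: H].
    rewrite (_ : [set: H] = set0) //; apply/seteqP.
    by split=> x; case: (H0 (inhabits x)).
  have [_ _ ageE] := G_limit.
  have [_ [f [_ f_rel]]] := (ageE _).2 (H_local Tfin).
  exists (fun x => f (exist _ x (mem_set I))).
  split=> [x|s x]; first by case: (H0 (inhabits x)).
  exact: (f_rel s (fun i => exist _ (x i) (mem_set I))).
have G0 : inhabited G.
  have [_ _ ageE] := G_limit.
  have [_ [f _]] := (ageE _).2 (H_local (finite_set1 h0)).
  by split; exact: (f (exist _ h0 (mem_set erefl))).
pose D k := [set x | (code x < k)%N].
have Dfin k : finite_set (D k).
  rewrite (_ : D k = code @^-1` `I_k) //; apply: finite_preimage.
    by move=> x y _ _; exact: code_inj.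
  exact: finite_II.
have [f0 f0P] := embedding_on_finite (Dfin 0%N) G0.
have /choice[ext extP] : forall p : nat * (H -> G), exists f',
    embedding_on (D p.1) p.2 ->
    embedding_on (D p.1.+1) f' /\ forall x, D p.1 x -> f' x = p.2 x.
  move=> [k f] /=; have [fP|] := pselect (embedding_on (D k) f); last by exists f.
  have [|f' f'P f'E] := @embedding_on_extend (D k) (D k.+1) f (Dfin _) _ G0 fP.
    by move=> x; rewrite /D /= => /ltnW.
  by exists f'.
pose F := fix F k := if k is k'.+1 then ext (k', F k') else f0.
have F_emb k : embedding_on (D k) (F k).
  by elim: k => [|k IH] //=; case: (extP (k, F k) IH).
have F_stable x d : F ((code x).+1 + d)%N x = F (code x).+1 x.
  elim: d => [|d IH]; first by rewrite addn0.
  rewrite addnS /= -[RHS]IH.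
  have [_ ->] := extP (_, _) (F_emb ((code x).+1 + d)%N) => //.
  by rewrite /D /= addSn ltnS leq_addr.
(* Stages extend one another, so a point is read at the first stage that contains it. *)
pose f x := F (code x).+1 x.
have fE k x : D k x -> f x = F k x.
  by move=> xk; rewrite /f -(F_stable x (k - (code x).+1)%N) subnKC.
exists f; split=> [x y|s x].
  pose k := (maxn (code x) (code y)).+1.
  have Dx : D k x by rewrite /D /= ltnS leq_maxl.
  have Dy : D k y by rewrite /D /= ltnS leq_maxr.
  by rewrite (fE k) // (fE k) //; exact: (F_emb k).1.
pose k := (\max_i code (x i)).+1.
have Dx i : D k (x i) by rewrite /D /= ltnS; exact: leq_bigmax.
rewrite -((F_emb k).2 s x Dx).
suff -> : f \o x = F k \o x by [].
by apply/funext => i; exact: fE.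
Qed.

End FraisseLimits.

(** * Quantifier-free types, and hypergraph axioms checked on finite substructures *)

Lemma comp_pair (A B : Type) (f : A -> B) (x y : A) :
  f \o tnth [tuple x; y] = tnth [tuple f x; f y].
Proof. by apply/funext => -[[|[|]]]. Qed.

Lemma fun_pair (A : Type) (x : 'I_2 -> A) :
  x = tnth [tuple x ord0; x ord_max].
Proof.
by apply/funext => -[[|[|//]] i]; rewrite /tnth /=; congr x; apply: val_inj.
Qed.

Lemma same_qf_typeP (L : rlang) (G : rstruct L) k (g h : 'I_k -> G) :
  same_qf_type g h <->
  (forall i j, g i = g j <-> h i = h j) /\
  forall (s : rsym L) (x : 'I_(rarity s) -> 'I_k),
    rinterp (g \o x) <-> rinterp (h \o x).
Proof.
split=> [gh|[gh_eq gh_rel]].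
  split=> [i j|s x]; first exact: (gh (QEq L i j)).
  exact: (gh (QRel x)).
by elim=> [i j|s x|phi IH|phi IH psi IH'] //=; rewrite ?IH ?IH'.
Qed.

Definition glt (n : nat) (G : rstruct (Log n)) (x y : G) : Prop :=
  @rinterp _ G og_lt (tnth [tuple x; y]).

Definition plt (n : nat) (G : rstruct (Lopg n)) (x y : G) : Prop :=
  @rinterp _ G opg_lt (tnth [tuple x; y]).

Lemma glt_embedding (n : nat) (G H : rstruct (Log n)) (f : H -> G) x y :
  rembedding f -> (glt (f x) (f y) <-> glt x y).
Proof.
move=> [_ f_rel].
by have := f_rel og_lt (tnth [tuple x; y]); rewrite comp_pair.
Qed.

Lemma plt_embedding (n : nat) (G H : rstruct (Lopg n)) (f : H -> G) x y :
  rembedding f -> (plt (f x) (f y) <-> plt x y).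
Proof.
move=> [_ f_rel].
by have := f_rel opg_lt (tnth [tuple x; y]); rewrite comp_pair.
Qed.

Lemma set_val_embedding (L : rlang) (G : rstruct L) (D : set G) :
  rembedding (fun x : rsub D => set_val x).
Proof. by split=> // x y /val_inj. Qed.

Lemma ordered_hypergraph_sub (n : nat) (G : rstruct (Log n)) (D : set G) :
  ordered_hypergraph G -> ordered_hypergraph (rsub D).
Proof.
have emb := set_val_embedding D.
have ltE (x y : rsub D) : glt x y <-> @glt n G (set_val x) (set_val y).
  by rewrite glt_embedding.
move=> [[irr tr tot] sym E_inj]; split; first split.
- by move=> x /ltE /irr.
- by move=> x y z /ltE xy /ltE yz; apply/ltE; exact: tr xy yz.
- move=> x y; have [/ltE|/val_inj|/ltE] := tot (set_val x) (set_val y).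
  + by constructor 1.
  + by constructor 2.
  + by constructor 3.
- by move=> x s; exact: (sym (fun i => set_val (x i)) s).
- by move=> x /E_inj x_inj i j ij; apply: x_inj; rewrite /= ij.
Qed.

Lemma ordered_partite_hypergraph_sub (n : nat) (G : rstruct (Lopg n)) (D : set G) :
  ordered_partite_hypergraph G -> ordered_partite_hypergraph (rsub D).
Proof.
have emb := set_val_embedding D.
have ltE (x y : rsub D) : plt x y <-> @plt n G (set_val x) (set_val y).
  by rewrite plt_embedding.
move=> [parts sym E_parts [irr tr tot] P_lt]; split; last 2 first.
- split.
  + by move=> x /ltE /irr.
  + by move=> x y z /ltE xy /ltE yz; apply/ltE; exact: tr xy yz.
  + move=> x y; have [/ltE|/val_inj|/ltE] := tot (set_val x) (set_val y).
    * by constructor 1.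
    * by constructor 2.
    * by constructor 3.
- by move=> i j x y ij Px Py; apply/ltE; exact: P_lt ij Px Py.
- by move=> x; exact: (parts (set_val x)).
- by move=> x s; exact: (sym (fun i => set_val (x i)) s).
- move=> x Ex i; have [y [[[j _ jy] Py] y_uniq]] := E_parts _ Ex i.
  exists (x j); split; first by split; [exists j|rewrite -jy in Py].
  move=> _ [[j' _ <-] Pj']; apply: val_inj.
  by rewrite -[LHS]/(set_val (x j)) jy; apply: y_uniq; split=> //; exists j'.
Qed.

Lemma range_finite (T : Type) (k : nat) (x : 'I_k -> T) : finite_set (range x).
Proof. exact/finite_image/finite_finset. Qed.

Lemma lift_range (T : Type) (k : nat) (x : 'I_k -> T) :
  exists (D : set T) (x' : 'I_k -> D),
    finite_set D /\ x = fun i => set_val (x' i).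
Proof.
have Dx i : range x (x i) by exists i.
exists (range x), (fun i => exist _ (x i) (mem_set (Dx i))); split=> //.
exact: range_finite.
Qed.

(** The definition of a Fraisse limit constrains only finite substructures; each axiom of a linear
    order mentions at most three points, so it can be checked there. The hypergraph axioms are
    transferred likewise, on the range of a tuple. *)
Lemma linear_order_local (T : Type) (lt : T -> T -> Prop) :
  (forall D : set T, finite_set D ->
     linear_order (fun x y : D => lt (set_val x) (set_val y))) ->
  linear_order lt.
Proof.
move=> loc.
have get x y z : exists (D : set T) (x' y' z' : D),
    [/\ set_val x' = x, set_val y' = y, set_val z' = z &
     linear_order (fun x y : D => lt (set_val x) (set_val y))].
  have [D [x' [Dfin x'E]]] := lift_range (tnth [tuple x; y; z]).
  exists D, (x' ord0), (x' (lift ord0 ord0)), (x' ord_max).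
  have E i : set_val (x' i) = tnth [tuple x; y; z] i by rewrite x'E.
  by rewrite !E; split=> //; exact: loc.
split=> [x|x y z|x y].
- by have [D [x' [_ [_ [<- _ _ [irr _ _]]]]]] := get x x x; exact: irr.
- have [D [x' [y' [z' [<- <- <- [_ tr _]]]]]] := get x y z; exact: tr.
- have [D [x' [y' [_ [<- <- _ [_ _ tot]]]]]] := get x y x.
  by have [|->|] := tot x' y'; [constructor 1|constructor 2|constructor 3].
Qed.

Lemma ordered_hypergraph_local (n : nat) (G : rstruct (Log n)) :
  (forall D : set G, finite_set D -> ordered_hypergraph (rsub D)) ->
  ordered_hypergraph G.
Proof.
move=> loc; split.
- apply: linear_order_local => D /loc[[irr tr tot] _ _].
  have ltE (x y : rsub D) : @glt n G (set_val x) (set_val y) <-> glt x y.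
    by rewrite glt_embedding //; exact: set_val_embedding.
  split=> [x /ltE /irr //|x y z /ltE xy /ltE yz|x y]; first exact/ltE/(tr _ y).
  have [/ltE|->|/ltE] := tot x y; [by constructor 1|by constructor 2|by constructor 3].
- move=> x s; have [D [x' [Dfin ->]]] := lift_range x.
  by have [_ sym _] := loc _ Dfin; exact: (sym x' s).
- move=> x; have [D [x' [Dfin ->]]] := lift_range x.
  have [_ _ E_inj] := loc _ Dfin => Ex i j /val_inj; exact: (E_inj x' Ex).
Qed.

Lemma ordered_partite_hypergraph_local (n : nat) (G : rstruct (Lopg n)) :
  (forall D : set G, finite_set D -> ordered_partite_hypergraph (rsub D)) ->
  ordered_partite_hypergraph G.
Proof.
move=> loc; split.
- move=> x; have [parts _ _ _ _] := loc _ (finite_set1 x).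
  exact: (parts (exist _ x (mem_set erefl))).
- move=> x s; have [D [x' [Dfin ->]]] := lift_range x.
  by have [_ sym _ _ _] := loc _ Dfin; exact: (sym x' s).
- move=> x; have [D [x' [Dfin ->]]] := lift_range x.
  have [_ _ E_parts _ _] := loc _ Dfin => Ex i; have [y [[[j _ jy] Py] y_uniq]] := E_parts x' Ex i.
  exists (set_val y); split; first by split=> //; exists j; rewrite ?jy.
  move=> _ [[j' _ <-] Pj']; congr set_val; apply: y_uniq.
  by split=> //; exists j'.
- apply: linear_order_local => D /loc[_ _ _ [irr tr tot] _].
  have ltE (x y : rsub D) : @plt n G (set_val x) (set_val y) <-> plt x y.
    by rewrite plt_embedding //; exact: set_val_embedding.
  split=> [x /ltE /irr //|x y z /ltE xy /ltE yz|x y]; first exact/ltE/(tr _ y).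
  have [/ltE|->|/ltE] := tot x y; [by constructor 1|by constructor 2|by constructor 3].
- move=> i j x y ij Px Py.
  have [D [x' [Dfin x'E]]] := lift_range (tnth [tuple x; y]).
  have [_ _ _ _ P_lt] := loc _ Dfin.
  have ex : set_val (x' ord0) = x by rewrite -[LHS]/((fun i => set_val (x' i)) _) -x'E.
  have ey : set_val (x' ord_max) = y.
    by rewrite -[LHS]/((fun i => set_val (x' i)) _) -x'E.
  have := P_lt i j (x' ord0) (x' ord_max) ij; rewrite /= ex ey => /(_ Px Py).
  by rewrite -[(fun i => set_val _)]/(set_val \o _) comp_pair ex ey.
Qed.

Lemma is_Gn1_hypergraph (n : nat) (G : rstruct (Log n)) :
  is_Gn1 G -> ordered_hypergraph G.
Proof.
by move=> /fraisse_limit_local loc; apply: ordered_hypergraph_local => D /loc[].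
Qed.

Lemma is_Gn1p_hypergraph (n : nat) (G : rstruct (Lopg n)) :
  is_Gn1p G -> ordered_partite_hypergraph G.
Proof.
move=> /fraisse_limit_local loc.
by apply: ordered_partite_hypergraph_local => D /loc[].
Qed.

Lemma is_Gn1_universal (n : nat) (G H : rstruct (Log n)) :
  is_Gn1 G -> ordered_hypergraph H -> countable [set: H] ->
  exists f : H -> G, rembedding f.
Proof.
move=> G_limit HH; apply: (fraisse_limit_universal G_limit) => D Dfin.
split; first by rewrite /rfinite (eq_finite_set (card_setT _)).
exact: ordered_hypergraph_sub.
Qed.

Lemma is_Gn1p_universal (n : nat) (G H : rstruct (Lopg n)) :
  is_Gn1p G -> ordered_partite_hypergraph H -> countable [set: H] ->
  exists f : H -> G, rembedding f.
Proof.
move=> G_limit HH; apply: (fraisse_limit_universal G_limit) => D Dfin.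
split; first by rewrite /rfinite (eq_finite_set (card_setT _)).
exact: ordered_partite_hypergraph_sub.
Qed.

(** * Forgetting the parts of a partite hypergraph, and covering a hypergraph by a partite one *)

Section Parts.
Variables (n : nat) (G : rstruct (Lopg n)).
Hypothesis G_partite : ordered_partite_hypergraph G.

Lemma part_function : exists part : G -> 'I_n.+1,
  forall x i, @rinterp _ G (opg_P i) (fun=> x) <-> i = part x.
Proof.
have [parts _ _ _ _] := G_partite.
have /choice[part partP] : forall x, exists i,
    @rinterp _ G (opg_P i) (fun=> x) /\
    forall j, @rinterp _ G (opg_P j) (fun=> x) -> i = j.
  by move=> x; have [i [Pi i_uniq]] := parts x; exists i.
exists part => x i; have [Pi Pu] := partP x.
by split=> [/Pu //|->].
Qed.

(** An edge meets all n + 1 parts with n + 1 entries, so it meets each of them once. *)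
Lemma edge_part_inj (part : G -> 'I_n.+1) (x : 'I_n.+1 -> G) :
  (forall x i, @rinterp _ G (opg_P i) (fun=> x) <-> i = part x) ->
  @rinterp _ G opg_R x -> injective (part \o x).
Proof.
move=> partP Ex; have [_ _ E_parts _ _] := G_partite.
have /choice[r rP] : forall i, exists j, part (x j) = i.
  move=> i; have [y [[[j _ <-] /partP ->] _]] := E_parts _ Ex i.
  by exists j.
have r_inj : injective r by move=> i j ij; rewrite -[i]rP -[j]rP ij.
have [r' rr' r'r] := injF_bij r_inj.
by move=> i j /= ij; rewrite -[i]r'r -[j]r'r -[r' i]rP -[r' j]rP !r'r ij.
Qed.

Definition forget_parts : rstruct (Log n) :=
  @RStruct (Log n) G (fun s => match s with
    | og_lt => @rinterp _ G opg_lt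
    | og_R => @rinterp _ G opg_R
    end).

Lemma forget_parts_hypergraph : ordered_hypergraph forget_parts.
Proof.
have [part partP] := part_function.
have [_ sym _ lin _] := G_partite; split=> //.
move=> x /(edge_part_inj partP) px_inj i j ij.
by apply: px_inj; rewrite /= ij.
Qed.

End Parts.

Section Cover.
Variables (n : nat) (G : rstruct (Log n)).

Definition cover : rstruct (Lopg n) :=
  @RStruct (Lopg n) (G * 'I_n.+1)%type (fun s => match s with
    | opg_lt => fun x : 'I_2 -> _ =>
        ((x ord0).2 < (x ord_max).2)%N \/
        ((x ord0).2 = (x ord_max).2 /\ glt (x ord0).1 (x ord_max).1)
    | opg_R => fun x => injective (snd \o x) /\ @rinterp _ G og_R (fst \o x)
    | opg_P i => fun x : 'I_1 -> _ => (x ord0).2 = i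
    end).

Lemma cover_hypergraph : ordered_hypergraph G -> ordered_partite_hypergraph cover.
Proof.
move=> [[irr tr tot] sym _]; split.
- by move=> [v i]; exists i; split=> // j.
- move=> x s; split=> -[x_inj Rx].
    split; last exact/(sym (fst \o x) s).
    move=> i j ij; rewrite -[i](permKV s) -[j](permKV s); congr (s _).
    by apply: x_inj; rewrite /= !permKV.
  split; last exact/(sym (fst \o x) s).
  by move=> i j /x_inj /perm_inj.
- move=> x [x_inj _] i; have [r xr rx] := injF_bij x_inj.
  exists (x (r i)); split; first by split; [exists (r i)|exact: rx].
  by move=> _ [[j _ <-] <-]; rewrite [r _]xr.
- split.
  + by move=> [v i] [|[_ /irr]] //=; rewrite ltnn.
  + move=> [v i] [w j] [z l] /= [ij|[<- vw]] [jl|[<- wz]].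
    * by left; exact: ltn_trans ij jl.
    * by left.
    * by left.
    * by right; split=> //; exact: tr vw wz.
  + move=> [v i] [w j]; case: (ltngtP i j) => [ij|ji|/ord_inj <-].
    * by constructor 1; left.
    * by constructor 3; left.
    * have [vw|->|wv] := tot v w.
      - by constructor 1; right.
      - by constructor 2.
      - by constructor 3; right.
- by move=> i j x y ij /= xi yj; left; move: ij; rewrite -xi -yj.
Qed.

End Cover.

Lemma countType_countable (T : countType) : countable [set: T].
Proof. exact: countableP. Qed.

Lemma prod_countable (A B : Type) :
  countable [set: A] -> countable [set: B] -> countable [set: A * B].
Proof. by move=> cA cB; rewrite -setXTT; exact: countableX. Qed.

(** * Transfer of indiscernibility from G_{n+1} to G_{n+1,p} *)

Section OrderToPartite.
Variables (R : realType) (L : signature R) (n : nat) (K : Type) (M : mstructure L).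
Variables (Gp : rstruct (Lopg n)) (G : rstruct (Log n)).
Hypotheses (K_nat : small K nat) (Gp_limit : is_Gn1p Gp) (G_limit : is_Gn1 G).

Lemma op_indiscernible_of_order :
  (forall (J : Type) (a : G -> J -> M), small K J ->
     indiscernible a -> indiscernible (G := o_reduct G) a) ->
  forall (J : Type) (a : Gp -> J -> M),
    indiscernible a -> indiscernible (G := op_reduct Gp) a.
Proof.
move=> order_ind J a a_ind k g h /same_qf_typeP[gh_eq gh_rel] phi.
have G_hyp := is_Gn1_hypergraph G_limit.
have Gp_hyp := is_Gn1p_hypergraph Gp_limit.
have [part partP] := part_function Gp_hyp.
have [cG _ _] := G_limit; have [cGp _ _] := Gp_limit.
have [theta theta_emb] : exists f : cover G -> Gp, rembedding f.
  apply: is_Gn1p_universal => //; first exact: cover_hypergraph.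
  apply: prod_countable => //; exact: countType_countable.
have [iota iota_emb] : exists f : forget_parts Gp -> G, rembedding f.
  apply: is_Gn1_universal => //; exact: forget_parts_hypergraph.
(* [J] is arbitrary; a finite support [F] of the formula keeps the tuples of [b] finite, as the
   hypothesis on small index types requires. *)
have [F [phi' [rho ->]]] := formula_finite_support phi.
pose b (v : G) (z : 'I_n.+1 * F) := a (theta (v, z.1)) (rho z.2).2.
have b_ind : indiscernible b.
  move=> k' v v' /same_qf_typeP[vv_eq vv_rel] psi.
  have lt_rel i j : glt (v i) (v j) <-> glt (v' i) (v' j).
    by have := vv_rel og_lt (tnth [tuple i; j]); rewrite !comp_pair.
  (* [tup] lists all n + 1 copies of every vertex; its quantifier-free type in the cover is
     determined by that of [w] in [G]. *)
  pose N := #|{: 'I_k' * 'I_n.+1}|.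
  pose tup (w : 'I_k' -> G) (m : 'I_N) : Gp :=
    theta (w (enum_val m).1, (enum_val m).2).
  have tupE w z : b (w z.1) z.2 =
      a (tup w (enum_rank (z.1, z.2.1))) (rho z.2.2).2.
    by rewrite /tup enum_rankK.
  suff /a_ind /(_ (fmap psi (fun z => (enum_rank (z.1, z.2.1), (rho z.2.2).2)))) :
      same_qf_type (tup v) (tup v').
    rewrite !feval_map; set x1 := _ \o _; set x2 := _ \o _ => E.
    have -> : (fun z => b (v z.1) z.2) = x1 by apply/funext => z; exact: tupE.
    by have -> : (fun z => b (v' z.1) z.2) = x2 by apply/funext => z; exact: tupE.
  apply/same_qf_typeP; split.
    move=> i j; rewrite /tup; split=> /(theta_emb.1) [] /vv_eq E1 E2;
      by rewrite E1 E2.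
  move=> s x.
  rewrite -[tup v \o x]/(theta \o (fun i => (v (enum_val (x i)).1, (enum_val (x i)).2))).
  rewrite -[tup v' \o x]/(theta \o (fun i => (v' (enum_val (x i)).1, (enum_val (x i)).2))).
  rewrite !(theta_emb.2).
  case: s x => [||i] x //=.
    by rewrite !lt_rel.
  by have -> := vv_rel og_R (fun i => (enum_val (x i)).1).
have gh_lt i j : plt (g i) (g j) <-> plt (h i) (h j).
  by have := gh_rel op_lt (tnth [tuple i; j]); rewrite !comp_pair.
have gh_part i : part (g i) = part (h i).
  apply/partP; have := gh_rel (op_P (part (g i))) (fun=> i) => /= <-.
  exact/partP.
have b_oind := order_ind _ b (small_countable K_nat (countType_countable _)) b_ind.
(* Sending a point to the copy, in its own part, of its image under [iota] embeds [Gp] into the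
   cover. So the values of [a] along [w] can be read from [b] at the vertices [iota (w i)], the part
   of [w i] selecting the coordinates. *)
have back (w : 'I_k -> Gp) : feval (fmap phi' rho) (fun z => a (w z.1) z.2) =
    feval (fmap phi' (fun f => ((rho f).1, (part (w (rho f).1), f))))
      (fun z => b (iota (w z.1)) z.2).
  pose w' (i : 'I_k) := theta (iota (w i), part (w i)).
  suff /a_ind -> : same_qf_type w w'.
    by rewrite !feval_map; congr feval; apply/funext => f.
  apply/same_qf_typeP; split=> [i j|s x].
    by split=> [E|/(theta_emb.1) [/(iota_emb.1)]] //; rewrite /w' E.
  rewrite -[w' \o x]/(theta \o (fun i => (iota (w (x i)), part (w (x i))))).
  rewrite (theta_emb.2); case: s x => [||i] x /=.
  - rewrite (glt_embedding _ _ iota_emb).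
    have -> : w \o x = tnth [tuple w (x ord0); w (x ord_max)].
      exact: (fun_pair (w \o x)).
    have [_ _ _ [irr tr tot] P_lt] := Gp_hyp.
    have P_part y : @rinterp _ Gp (opg_P (part y)) (fun=> y) by exact/partP.
    split=> [lt_xy|[lt_p|[_ //]]]; last exact: P_lt lt_p (P_part _) (P_part _).
    case: (ltngtP (part (w (x ord0))) (part (w (x ord_max)))) => [|lt_p|/ord_inj E].
    + by left.
    + have := P_lt _ _ _ _ lt_p (P_part _) (P_part _).
      by move=> /(tr _ _ _ lt_xy) /irr.
    + by right.
  - have -> : (fst \o (fun i => (iota (w (x i)), part (w (x i))))) = iota \o (w \o x).
      by [].
    rewrite (iota_emb.2 og_R (w \o x)) /=.
    by split=> [E|[]//]; split=> //; exact: (edge_part_inj Gp_hyp partP E).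
  - have -> : w \o x = fun=> w (x ord0).
      by apply/funext => j; rewrite /= (ord1 j).
    by rewrite partP; split=> ->.
rewrite !back.
have -> : (fun f => ((rho f).1, (part (h (rho f).1), f))) =
    (fun f => ((rho f).1, (part (g (rho f).1), f))).
  by apply/funext => f; rewrite gh_part.
suff gh_o : @same_qf_type Lo (o_reduct G) k (iota \o g) (iota \o h).
  exact: (b_oind k _ _ gh_o).
apply/same_qf_typeP; split=> [i j|[] x].
  by split=> /(iota_emb.1) /gh_eq E; rewrite /= E.
rewrite /= [x]fun_pair -![_ \o tnth _]/((iota \o _) \o tnth _) !comp_pair.
have iota_lt y z : glt (iota y) (iota z) <-> @plt n Gp y z.
  exact: (glt_embedding y z iota_emb).
exact: (iff_trans (iota_lt _ _) (iff_trans (gh_lt _ _) (iff_sym (iota_lt _ _)))).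
Qed.

End OrderToPartite.

(** * Increasing enumerations and prescribed edge patterns *)

Section IncreasingTuples.
Variables (T : Type) (lt : T -> T -> Prop).
Hypothesis lt_linear : linear_order lt.

Definition lt_increasing k (g : 'I_k -> T) : Prop :=
  forall i j : 'I_k, (i < j)%N -> lt (g i) (g j).

Lemma lt_increasingP k (g : 'I_k -> T) i j : lt_increasing g ->
  (lt (g i) (g j) <-> (i < j)%N).
Proof.
have [irr tr _] := lt_linear.
move=> incg; split=> [gij|/incg //]; case: (ltngtP i j) => // [/incg gji|/ord_inj ij].
  by case: (irr (g i)); exact: tr gij gji.
by move: gij; rewrite ij => /irr.
Qed.

Lemma lt_increasing_inj k (g : 'I_k -> T) : lt_increasing g -> injective g.
Proof.
have [irr _ _] := lt_linear.
move=> incg i j gij; case: (ltngtP i j) => [/incg|/incg|/ord_inj //];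
  by rewrite gij => /irr.
Qed.

(** [T] is a bare type with a propositional order, so indices are sorted instead of values, each
    value being represented by its first index. *)
Lemma increasing_enumeration k (g : 'I_k -> T) :
  exists s (g' : 'I_s -> T) (tau : 'I_k -> 'I_s) (tau' : 'I_s -> 'I_k),
    [/\ lt_increasing g', g = g' \o tau & cancel tau' tau].
Proof.
have [irr tr tot] := lt_linear.
pose le (i j : 'I_k) := `[< ~ lt (g j) (g i) >].
have le_total : total le.
  move=> i j; apply/orP; have [ij|ij] := pselect (lt (g i) (g j)).
    by left; apply/asboolP => /(tr _ _ _ ij) /irr.
  by right; apply/asboolP.
have le_trans : transitive le.
  move=> j i l /asboolP ij /asboolP jl; apply/asboolP => li.
  have [ji|E|//] := tot (g i) (g j).
    by apply: jl; exact: tr li ji.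
  by apply: jl; rewrite -E.
pose rep (i : 'I_k) := `[< forall j : 'I_k, (j < i)%N -> g j <> g i >].
pose l := sort le [seq i <- enum 'I_k | rep i].
have l_uniq : uniq l by rewrite sort_uniq filter_uniq // enum_uniq.
have mem_l i : (i \in l) = rep i by rewrite mem_sort mem_filter mem_enum andbT.
have l_sorted : sorted le l by exact: sort_sorted.
pose t := in_tuple l.
have /choice[tau tauE] : forall i : 'I_k, exists j : 'I_(size l), g (tnth t j) = g i.
  move=> i; pose P (j : 'I_k) := `[< g j = g i >].
  have Pi : P i by exact/asboolP.
  have [i0 /asboolP i0E i0_min] := arg_minnP (fun j : 'I_k => j : nat) Pi.
  have : i0 \in l.
    rewrite mem_l; apply/asboolP => j ji jE.
    have /i0_min : P j by apply/asboolP; rewrite jE.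
    by rewrite leqNgt ji.
  by move=> /(tnthP t)[j jE]; exists j; rewrite -jE.
have incr : lt_increasing (g \o tnth t).
  move=> i j ij; have i_lt := ltn_ord i; have j_lt := ltn_ord j.
  have nthE (m : 'I_(size l)) : tnth t m = nth (tnth t i) l m by exact: tnth_nth.
  have : le (tnth t i) (tnth t j).
    rewrite (nthE i) (nthE j); exact: (sorted_ltn_nth le_trans).
  move=> /asboolP nji; have [//|E|//] := tot (g (tnth t i)) (g (tnth t j)).
  have ne : tnth t i <> tnth t j.
    move=> /eqP; rewrite (nthE i) (nthE j) nth_uniq // => /eqP ijE.
    by move: ij; rewrite ijE ltnn.
  have repi : rep (tnth t i) by rewrite -mem_l mem_tnth.
  have repj : rep (tnth t j) by rewrite -mem_l mem_tnth.
  case: (ltngtP (tnth t i) (tnth t j)) => [lij|lji|/ord_inj //].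
    by move: repj => /asboolP /(_ _ lij).
  by move: repi => /asboolP /(_ _ lji) /(_ (esym E)).
exists (size l), (g \o tnth t), tau, (tnth t); split=> //.
  by apply/funext => i /=; rewrite tauE.
by move=> i; apply: (lt_increasing_inj incr); rewrite /= tauE.
Qed.

(** What sorts [g] depends only on its equalities and its order, so the same [tau] serves [h]. *)
Lemma common_enumeration k (g h : 'I_k -> T) :
  (forall i j, g i = g j <-> h i = h j) ->
  (forall i j, lt (g i) (g j) <-> lt (h i) (h j)) ->
  exists s (g' h' : 'I_s -> T) (tau : 'I_k -> 'I_s) (tau' : 'I_s -> 'I_k),
    [/\ lt_increasing g', lt_increasing h', g = g' \o tau, h = h' \o tau
      & g' = g \o tau' /\ h' = h \o tau'].
Proof.
move=> gh_eq gh_lt.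
have [s [g' [tau [tau' [incg' gE tauK]]]]] := increasing_enumeration g.
have g'E i : g' i = g (tau' i) by rewrite gE /= tauK.
exists s, g', (h \o tau'), tau, tau'; split=> //.
- by move=> i j /incg'; rewrite !g'E => /gh_lt.
- apply/funext => i /=; apply/gh_eq; rewrite -g'E.
  by rewrite {1}gE.
- by split=> //; apply/funext.
Qed.

End IncreasingTuples.

Lemma ltn_linear (m : nat) : linear_order (fun i j : 'I_m => (i < j)%N).
Proof.
split=> [i|i j l|i j]; rewrite ?ltnn //; first exact: ltn_trans.
by case: (ltngtP i j) => [||/ord_inj]; [constructor 1|constructor 3|constructor 2].
Qed.

Lemma increasing_self (k : nat) (f : 'I_k -> 'I_k) : increasing f -> f = id.
Proof.
move=> incf; have := size_subseq_leqif (increasing_codom_subseq incf).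
rewrite size_codom size_enum_ord card_ord => -[_]; rewrite eqxx => /esym/eqP E.
apply/funext => i; have : map f (enum 'I_k) = map id (enum 'I_k).
  by rewrite map_id -[RHS]E codomE.
by move=> /eq_in_map /(_ i); rewrite mem_enum; apply.
Qed.

Lemma increasing_perm (r m : nat) (x : 'I_r -> 'I_m) :
  injective x -> exists s : {perm 'I_r}, increasing (x \o s).
Proof.
move=> x_inj.
have [s [x' [tau [tau' [incx' xE tauK]]]]] := increasing_enumeration (ltn_linear m) x.
have tau_inj : injective tau by move=> i j ij; apply: x_inj; rewrite xE /= ij.
have rs : s = r.
  have := leq_card _ (can_inj tauK); have := leq_card _ tau_inj.
  by rewrite !card_ord => rs sr; apply/eqP; rewrite eqn_leq rs sr.
subst s; exists (perm (can_inj tauK)) => i j /incx'.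
by rewrite /= !permE xE /= !tauK.
Qed.

Section HypergraphOfOrder.
Variables (n : nat) (T : Type) (lt : T -> T -> Prop).
Variable E : ('I_n.+1 -> T) -> Prop.
Hypothesis lt_linear : linear_order lt.

(** Testing [E] on the increasing rearrangement of a tuple makes an arbitrary relation symmetric and
    leaves it unchanged on increasing tuples. *)
Definition hypergraph_of : rstruct (Log n) :=
  @RStruct (Log n) T (fun s => match s with
    | og_lt => fun x : 'I_2 -> T => lt (x ord0) (x ord_max)
    | og_R => fun x => exists2 s : {perm 'I_n.+1},
        lt_increasing lt (x \o s) & E (x \o s)
    end).

Lemma hypergraph_of_ordered : ordered_hypergraph hypergraph_of.
Proof.
split=> //=.
- move=> x s; split=> -[t inct Et].
    by exists (t * s)%g; rewrite (_ : x \o _ = (x \o s) \o t) //;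
      apply/funext => i; rewrite /= permM.
  exists (t * s^-1)%g; rewrite (_ : (x \o s) \o _ = x \o t) //;
    by apply/funext => i; rewrite /= permM permKV.
- move=> x [s incs _] i j ij; rewrite -[i](permKV s) -[j](permKV s); congr (s _).
  by apply: (lt_increasing_inj lt_linear incs); rewrite /= !permKV.
Qed.

Lemma hypergraph_of_edge (x : 'I_n.+1 -> T) : lt_increasing lt x ->
  (@rinterp _ hypergraph_of og_R x <-> E x).
Proof.
move=> incx; split=> [[s incs]|Ex].
  have -> : (s : 'I_n.+1 -> 'I_n.+1) = id.
    apply: increasing_self => i j /incs /=.
    by rewrite (lt_increasingP lt_linear).
  by [].
exists 1%g; rewrite (_ : x \o _ = x) //; by apply/funext => i; rewrite /= perm1.
Qed.

End HypergraphOfOrder.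

Lemma increasing_same_qf_type (n : nat) (G : rstruct (Log n)) m (g h : 'I_m -> G) :
  ordered_hypergraph G ->
  lt_increasing (@glt n G) g -> lt_increasing (@glt n G) h ->
  (forall x : 'I_n.+1 -> 'I_m, increasing x ->
     (@rinterp _ G og_R (g \o x) <-> @rinterp _ G og_R (h \o x))) ->
  same_qf_type g h.
Proof.
move=> [lin sym E_inj] incg inch ghE.
have g_inj := lt_increasing_inj lin incg; have h_inj := lt_increasing_inj lin inch.
apply/same_qf_typeP; split=> [i j|[] x].
- by split=> [/g_inj|/h_inj] ->.
- rewrite [x]fun_pair !comp_pair; set i := x _; set j := x _.
  exact: (iff_trans (lt_increasingP lin i j incg) (iff_sym (lt_increasingP lin i j inch))).
- have [x_inj|x_ninj] := pselect (injective x); last first.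
    split=> /E_inj x_inj; case: x_ninj => i j ij; apply: x_inj; by rewrite /= ij.
  have [s incs] := increasing_perm x_inj.
  have := ghE _ incs.
  by rewrite (sym (g \o x) s) (sym (h \o x) s).
Qed.

Lemma is_Gn1_realize (n m : nat) (G : rstruct (Log n))
    (E : ('I_n.+1 -> 'I_m) -> Prop) : is_Gn1 G ->
  exists g : 'I_m -> G, lt_increasing (@glt n G) g /\
    forall x : 'I_n.+1 -> 'I_m, increasing x -> (@rinterp _ G og_R (g \o x) <-> E x).
Proof.
move=> G_limit; have lin := ltn_linear m.
have [f f_emb] := is_Gn1_universal G_limit (hypergraph_of_ordered E lin)
  (countType_countable 'I_m).
exists f; split=> [i j ij|x incx].
  exact: ((@glt_embedding _ _ _ f i j f_emb).2 ij).
rewrite (f_emb.2 og_R x); exact: hypergraph_of_edge.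
Qed.

(** * Blow-ups, and IP_n from a failure of order indiscernibility *)

Definition lex (m : nat) (p q : 'I_m * nat) : Prop :=
  (p.1 < q.1)%N \/ (p.1 = q.1 /\ (p.2 < q.2)%N).

Lemma lex_linear (m : nat) : linear_order (@lex m).
Proof.
split=> [[i a]|[i a] [j b] [l c]|[i a] [j b]]; rewrite /lex /=.
- by rewrite !ltnn => -[|[]].
- move=> [ij|[<- ab]] [jl|[<- bc]].
  + by left; exact: ltn_trans ij jl.
  + by left.
  + by left.
  + by right; split=> //; exact: ltn_trans ab bc.
- case: (ltngtP i j) => [ij|ji|/ord_inj <-].
  + by constructor 1; left.
  + by constructor 3; left.
  + case: (ltngtP a b) => [ab|ba|<-].
    * by constructor 1; right.
    * by constructor 3; right.
    * by constructor 2.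
Qed.

Definition finset_code (n : nat) (c : nat) : set ('I_n -> nat) :=
  fun j => if @unpickle (seq {ffun 'I_n -> nat}) c is Some l
           then finfun j \in l else False.

Lemma finset_code_surj (n : nat) (w : set ('I_n -> nat)) :
  finite_set w -> exists c, forall j, finset_code c j <-> w j.
Proof.
move=> w_fin; have /finite_seqP[l lE] :
    finite_set ((fun j : 'I_n -> nat => finfun j : {ffun 'I_n -> nat}) @` w).
  exact: finite_image.
exists (pickle l) => j; rewrite /finset_code pickleK.
have -> : (finfun j \in l) = [set` l] (finfun j) :> Prop by [].
rewrite -lE; split=> [[j' wj' /ffunP jj']|wj]; last by exists j.
by rewrite (_ : j = j') //; apply/funext => i; have := jj' i; rewrite !ffunE.
Qed.

Section OneEdge.
Variables (T : finType) (V : Type) (Theta : (T -> Prop) -> V).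

(** If adding one point never changed [Theta], emptying a set along an enumeration of [T] would make
    [Theta] constant. *)
Lemma one_point_difference (E E' : T -> Prop) : Theta E <> Theta E' ->
  exists (D : T -> Prop) (x0 : T),
    ~ D x0 /\ Theta D <> Theta (fun x => x = x0 \/ D x).
Proof.
move=> neq; apply: contrapT => none; apply: neq.
suff key D : Theta D = Theta (fun=> False) by rewrite !key.
have -> : D = fun x => x \in enum T /\ D x.
  by apply/funext => x; rewrite mem_enum; apply/propext; split=> // -[].
elim: (enum T) => [|x0 l <-].
  by congr Theta; apply/funext => x; apply/propext; split=> // -[].
have [Dl|nDl] := pselect (x0 \in l \/ ~ D x0).
  congr Theta; apply/funext => x; apply/propext; rewrite in_cons.
  split=> [[/orP[/eqP ->|xl] Dx]|[xl Dx]] //; last by rewrite xl orbT.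
  by case: Dl.
apply: contrapT => neq; apply: none.
exists (fun x => x \in l /\ D x), x0; split=> [[x0l _]|E0]; first by apply: nDl; left.
apply: neq; rewrite E0; congr Theta; apply/funext => x; apply/propext.
rewrite in_cons; split=> [[/orP[/eqP ->|xl] Dx]|[->|[xl Dx]]].
- by left.
- by right.
- rewrite eqxx; split=> //; apply: contrapT => nD; apply: nDl; by right.
- by rewrite xl orbT.
Qed.

End OneEdge.

Section DependentToOrder.
Variables (R : realType) (L : signature R) (n : nat) (M : mstructure L).
Variable G : rstruct (Log n).
Hypothesis G_limit : is_Gn1 G.

Local Notation edge := (@rinterp _ G og_R).
Local Notation gincr := (lt_increasing (@glt n G)).

Let wid (i : 'I_n) : 'I_n.+1 := widen_ord (leqnSn n) i.

(* The blow-up of a pattern [D] along the tuple [x0]: the i-th vertex of [x0]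
   is replaced by countably many copies (x0 i, j), the last one by copies coding
   the finite sets, and an edge above [x0] says whether (j_i) is in the set. *)
Lemma blowup (m : nat) (D : ('I_n.+1 -> 'I_m) -> Prop) (x0 : 'I_n.+1 -> 'I_m)
    (B : Prop) : increasing x0 ->
  exists th : 'I_m * nat -> G,
  forall (pos : 'I_m -> nat), let g := fun t => th (t, pos t) in
    gincr g /\
    forall x : 'I_n.+1 -> 'I_m, increasing x ->
    (edge (g \o x) <->
     (x <> x0 /\ D x) \/
     (x = x0 /\ (finset_code (pos (x0 ord_max)) (fun i => pos (x0 (wid i))) <-> B))).
Proof.
move=> incx0.
pose E (y : 'I_n.+1 -> 'I_m * nat) := let x := fst \o y in
  (x <> x0 /\ D x) \/
  (x = x0 /\ (finset_code (y ord_max).2 (fun i => (y (wid i)).2) <-> B)).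
have lin := lex_linear m.
have [f f_emb] := is_Gn1_universal G_limit (hypergraph_of_ordered E lin)
  (countType_countable ('I_m * nat)%type).
exists f => pos g.
have incr_pos k (x : 'I_k -> 'I_m) : increasing x ->
    lt_increasing (@lex m) (fun t => (x t, pos (x t))).
  by move=> incx i j /incx; left.
split=> [i j ij|x incx].
  by apply: ((@glt_embedding _ _ _ f _ _ f_emb).2); left.
have -> : g \o x = f \o (fun t => (x t, pos (x t))) by [].
rewrite (f_emb.2 og_R) hypergraph_of_edge //; last exact: incr_pos.
rewrite /E /=; have -> : fst \o (fun t => (x t, pos (x t))) = x by [].
by split=> -[|[xx0 H]]; [left|right; rewrite -xx0|left|right; rewrite xx0 in H *].
Qed.

Theorem order_indiscernible_of_dependent : n_dependent n M ->
  forall (J : Type) (a : G -> J -> M),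
    indiscernible a -> indiscernible (G := o_reduct G) a.
Proof.
move=> dep J a a_ind k g h /same_qf_typeP[gh_eq gh_rel] phi.
have G_hyp := is_Gn1_hypergraph G_limit; have [lin _ _] := G_hyp.
apply: contrapT => neq.
have [||m [g' [h' [tau [_ [incg' inch' gE hE _]]]]]] :=
    @common_enumeration _ (@glt n G) lin k g h.
- exact: gh_eq.
- by move=> i j; have := gh_rel o_lt (tnth [tuple i; j]); rewrite !comp_pair.
have [F [phi' [rho phiE]]] :=
  formula_finite_support (fmap phi (fun z : 'I_k * J => (tau z.1, z.2))).
pose val_at (w : 'I_m -> G) : R :=
  feval phi' (fun f => a (w (rho f).1) (rho f).2).
have val_atE w : val_at w = feval phi (fun z => a (w (tau z.1)) z.2).
  have := feval_map phi (fun z : 'I_k * J => (tau z.1, z.2))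
    (fun z => a (w z.1) z.2).
  by rewrite phiE feval_map.
have {}neq : val_at g' <> val_at h' by rewrite !val_atE; rewrite gE hE in neq.
have val_same w w' : gincr w -> gincr w' ->
    (forall x : 'I_n.+1 -> 'I_m, increasing x -> (edge (w \o x) <-> edge (w' \o x))) ->
    val_at w = val_at w'.
  move=> incw incw' same.
  have /a_ind/(_ (fmap phi' rho)) := increasing_same_qf_type G_hyp incw incw' same.
  by rewrite !feval_map.
have /choice[real realP] := fun E : ('I_n.+1 -> 'I_m) -> Prop =>
  is_Gn1_realize E G_limit.
pose setF (E : {ffun 'I_n.+1 -> 'I_m} -> Prop) (x : 'I_n.+1 -> 'I_m) := E (finfun x).
(* By indiscernibility the choice of the realization is immaterial. Tuples of positions are taken as
   finite functions so that [one_point_difference] applies. *)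
pose Theta (E : {ffun 'I_n.+1 -> 'I_m} -> Prop) := val_at (real (setF E)).
have ThetaE w (E : {ffun 'I_n.+1 -> 'I_m} -> Prop) : gincr w ->
    (forall x : 'I_n.+1 -> 'I_m, increasing x -> (edge (w \o x) <-> E (finfun x))) ->
    val_at w = Theta E.
  move=> incw wE; have [incr rE] := realP (setF E).
  by apply: val_same => // x incx; rewrite rE // wE.
have ffunK (x : {ffun 'I_n.+1 -> 'I_m}) : finfun x = x by apply/ffunP => i; rewrite ffunE.
have funK (x : 'I_n.+1 -> 'I_m) : finfun x = x :> (_ -> _).
  by apply/funext => i; rewrite ffunE.
have [D [x0 [nDx0 D_neq]]] : exists (D : {ffun 'I_n.+1 -> 'I_m} -> Prop) x0,
    ~ D x0 /\ Theta D <> Theta (fun x => x = x0 \/ D x).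
  apply: (@one_point_difference _ _ Theta (fun x => edge (g' \o x))
    (fun x => edge (h' \o x))).
  by rewrite -(ThetaE g') -?(ThetaE h') // => x incx; rewrite funK.
(* [Theta] does not see tuples that are not increasing, so the critical one is increasing. *)
have incx0 : increasing x0.
  apply: contrapT => ninc; apply: D_neq.
  have [incr rE] := realP (setF D); apply: ThetaE => // x incx.
  rewrite rE // /setF; split=> [|[xE|//]]; first by right.
  by case: ninc; rewrite -xE funK.
(* IP_n wants the lower value on the set. [B] says whether the edge at [x0] lowers the value;
   accordingly the blow-up puts its edges on the set or on its complement. *)
pose B := Theta (fun x => x = x0 \/ D x) < Theta D.
have [th thP] := blowup (setF D) B incx0.
pose low := Num.min (Theta D) (Theta (fun x => x = x0 \/ D x)).
pose high := Num.max (Theta D) (Theta (fun x => x = x0 \/ D x)).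
have low_high : low < high.
  by rewrite /low /high; have [|//|/D_neq] := ltgtP (Theta D) _.
have val_pos (pos : 'I_m -> nat) : val_at (fun t => th (t, pos t)) =
    if pselect (finset_code (pos (x0 ord_max)) (fun i => pos (x0 (wid i))))
    then low else high.
  have [incp edgep] := thP pos.
  have edge_case (b : Prop) :
      ((finset_code (pos (x0 ord_max)) (fun i => pos (x0 (wid i))) <-> B) <-> b) ->
      val_at (fun t => th (t, pos t)) = Theta (fun x => (b /\ x = x0) \/ D x).
    move=> bE; apply: ThetaE => // x incx; rewrite edgep // bE /setF.
    have xx0 : finfun x = x0 <-> x = x0.
      split=> [<-|->]; last exact: ffunK.
      by rewrite funK.
    rewrite xx0; split=> [[[_ Dx]|[-> bb]]|[[bb ->]|Dx]]; [by right|by left|by right|].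
    by left; split=> // E; apply: nDx0; rewrite -(xx0.2 E).
  have ThT : Theta (fun x => (True /\ x = x0) \/ D x) = Theta (fun x => x = x0 \/ D x).
    by congr Theta; apply/funext => x; apply/propext; tauto.
  have ThF : Theta (fun x => (False /\ x = x0) \/ D x) = Theta D.
    by congr Theta; apply/funext => x; apply/propext; tauto.
  rewrite /low /high /B in edge_case *.
  case: pselect => inw; have [lt_D|lt_D|//] := ltgtP (Theta D) (Theta _).
  - rewrite (edge_case False) ?ThF //; split=> // -[/(_ inw)].
    by rewrite lt_gtF.
  - by rewrite (edge_case True) ?ThT //; split.
  - rewrite (edge_case True) ?ThT //; split=> // _; split=> //.
    by rewrite lt_gtF.
  - by rewrite (edge_case False) ?ThF //; split=> // -[_ /(_ lt_D)].
pose N := #|F|.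
pose isx0 (t : 'I_m) := [pick i : 'I_n | x0 (wid i) == t].
(* The variables at the i-th vertex of [x0], for i < n, go to y_i; those at the last vertex and at
   vertices off [x0] are gathered into x. *)
pose f : formula L ('I_N + {i : 'I_n & 'I_N}) := fmap phi' (fun z =>
  if isx0 (rho z).1 is Some i then inr (existT _ i (enum_rank z))
  else inl (enum_rank z)).
apply: (dep N (fun=> N) f).
exists low, high, (fun i j z => a (th (x0 (wid i), j)) (rho (enum_val z)).2).
split=> // w w_fin; have [c cw] := finset_code_surj w_fin.
(* The copy of the last vertex is the one coding [w]; for vertices off [x0] copy 0 will do. *)
pose last_pos (t : 'I_m) := if t == x0 ord_max then c else 0%N.
exists (fun z => let q := rho (enum_val z) in a (th (q.1, last_pos q.1)) q.2) => j v.
pose pos (t : 'I_m) := if isx0 t is Some i then j i else last_pos t.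
have x0_inj := increasing_inj incx0.
have pos_wid i : pos (x0 (wid i)) = j i.
  rewrite /pos /isx0; case: pickP => [i' /eqP /x0_inj|/(_ i)]; last by rewrite eqxx.
  by move=> /(congr1 val) /= /ord_inj ->.
have pos_last : pos (x0 ord_max) = c.
  rewrite /pos /isx0; case: pickP => [i' /eqP /x0_inj /(congr1 val) /= E|_].
    by have := ltn_ord i'; rewrite E ltnn.
  by rewrite /last_pos eqxx.
have vE : v = val_at (fun t => th (t, pos t)).
  rewrite /v /f feval_map; congr feval; apply/funext => z /=.
  rewrite /pos; case E : (isx0 (rho z).1) => [i|] /=; rewrite enum_rankK //.
  by move: E; rewrite /isx0; case: pickP => // i' /eqP <- [<-].
rewrite vE val_pos pos_last; under eq_fun do rewrite pos_wid.
have -> : finset_code c (fun i => j i) = w j :> Prop by exact/propext.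
case: pselect => wj /=; split; rewrite ?lexx; split=> //.
- by rewrite leNgt low_high.
- by rewrite leNgt low_high.
Qed.

End DependentToOrder.

(** * From IP_n to a G_{n+1}-indiscernible sequence with definable edges *)

Lemma discretization (R : realType) (B e : R) : 0 < e ->
  exists (N : nat) (d : R -> 'I_N), forall x y,
    `|x| <= B -> `|y| <= B -> d x = d y -> `|x - y| <= e.
Proof.
move=> e0; pose q x := Num.trunc ((x + B) / e).
exists (Num.trunc ((B + B) / e)).+1, (fun x => inord (q x)) => x y xB yB.
have q_bound z : `|z| <= B -> 0 <= (z + B) / e /\ (q z < (Num.trunc ((B + B) / e)).+1)%N.
  rewrite ler_norml => /andP[Bz zB]; split.
    by rewrite divr_ge0 ?(ltW e0) // -lerBlDr sub0r.
  by rewrite ltnS; apply: le_truncn; rewrite ler_pM2r ?invr_gt0 // lerD2r.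
have [x0 xN] := q_bound x xB; have [y0 yN] := q_bound y yB.
move=> /(congr1 val); rewrite /= !inordK // => qxy.
have /andP[] := truncn_itv x0; have /andP[] := truncn_itv y0.
rewrite -/(q x) -/(q y) qxy -natr1 => qy yq qx xq.
have -> : x - y = ((x + B) / e - (y + B) / e) * e.
  by rewrite -mulrBl mulfVK ?gt_eqF // opprD addrACA subrr addr0.
rewrite normrM (gtr0_norm e0) ler_piMl ?(ltW e0) // ler_norml; apply/andP; split; lra.
Qed.

Section Coding.
Variables (R : realType) (L : signature R) (n : nat) (K : Type) (M : mstructure L).
Variable G : rstruct (Log n).
Hypotheses (K_nat : small K nat) (M_sat : saturated K M) (G_limit : is_Gn1 G).
Variables (p : nat) (q : 'I_n -> nat).

Local Notation edge := (@rinterp _ G og_R).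
Local Notation gincr := (lt_increasing (@glt n G)).

Let wid (i : 'I_n) : 'I_n.+1 := widen_ord (leqnSn n) i.
Let J : finType := ('I_p + {i : 'I_n & 'I_(q i)})%type.

Variable f : formula L J.

(* The last vertex of an edge plays the role of the variable x of [f], the
   others those of y_0, ..., y_{n-1}. *)
Let F : formula L ('I_n.+1 * J) :=
  fmap f (fun z => match z with
    | inl _ => (ord_max, z)
    | inr u => (wid (tag u), z)
    end).

(** For a fixed tuple this is a closed condition on the value, so it survives limits; with r < s it
    still separates edges from nonedges. *)
Definition codes (r s : R) (V : Type) (E : ('I_n.+1 -> V) -> Prop)
    (c : V -> J -> M) (x : 'I_n.+1 -> V) : Prop :=
  let v := feval F (fun z => c (x z.1) z.2) in
  (E x -> v <= r) /\ (~ E x -> s <= v).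

(** Every vertex plays all roles: its x-part is the witness for the finite set of index tuples that
    form an edge with it as last vertex, its y-parts are the points a_i at its number. *)
Lemma has_IP_codes : has_IP M f -> exists r s : R, r < s /\
  forall (V : finType) (E : ('I_n.+1 -> V) -> Prop),
  exists c : V -> J -> M, forall x, codes r s E c x.
Proof.
move=> [r [s [a [rs HIP]]]]; exists r, s; split=> // V E.
pose num (v : V) : nat := enum_rank v.
have num_inj : injective num by move=> v v' /ord_inj /enum_rank_inj.
pose w (v : V) : set ('I_n -> nat) := [set j |
  exists2 x : {ffun 'I_n.+1 -> V}, E x & x ord_max = v /\
    j = fun i => num (x (wid i))].
have w_fin v : finite_set (w v).
  apply: (@sub_finite_set _ _
    ((fun (x : {ffun 'I_n.+1 -> V}) i => num (x (wid i))) @` setT)).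
    by move=> _ [x _ [_ ->]]; exists x.
  exact/finite_image/finite_finset.
have /choice[b bP] := fun v => HIP (w v) (w_fin v).
exists (fun v z => match z with
  | inl k => b v k
  | inr u => a (tag u) (num v) (tagged u)
  end) => x.
have [lowE highE] := bP (x ord_max) (fun i => num (x (wid i))).
have wE : w (x ord_max) (fun i => num (x (wid i))) <-> E x.
  split=> [[y Ey [ylast /(congr1 (fun g => g _)) ynum]]|Ex]; last first.
    exists (finfun x); last first.
      by split; [rewrite ffunE|apply/funext => i; rewrite ffunE].
    by rewrite (_ : finfun x = x :> (_ -> _)) //; apply/funext => i; rewrite ffunE.
  rewrite (_ : x = y) //; apply/funext => i.
  have [i_n|n_i] := ltnP i n.
    rewrite (_ : i = wid (Ordinal i_n)); last exact: val_inj.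
    exact/num_inj/ynum.
  rewrite (_ : i = ord_max) //; apply: val_inj; apply/eqP.
  by rewrite eqn_leq n_i andbT -ltnS ltn_ord.
rewrite /codes /F feval_map; set v := feval f _.
have -> : v = feval f (fun z => match z with
    | inl k => b (x ord_max) k
    | inr u => a (tag u) (num (x (wid (tag u)))) (tagged u)
    end).
  by congr feval; apply/funext => -[k|u].
by split=> [/wE/lowE|nE]; [|apply/highE => /wE].
Qed.

Variables (r s : R).
Hypothesis coded : forall (V : finType) (E : ('I_n.+1 -> V) -> Prop),
  exists c : V -> J -> M, forall x, codes r s E c x.

(** The colour of a tuple of the Ramsey host records, for each formula of [l] and each substitution
    [tau] of its variables, the value rounded to precision e. The whole host is coded before the
    copy is chosen, so the copy inherits a coding of [EA]. *)
Lemma approximately_indiscernible (a : nat) (EA : ('I_n.+1 -> 'I_a) -> Prop)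
    (l : seq {k : nat & formula L ('I_k * J)}) (e : R) : 0 < e ->
  exists c : 'I_a -> J -> M, (forall x, increasing x -> codes r s EA c x) /\
    forall i : 'I_(size l), let: existT k phi := tnth (in_tuple l) i in
    forall m (u u' : 'I_m -> 'I_a) (tau : 'I_k -> 'I_m),
      increasing u -> increasing u' ->
      (forall x : 'I_n.+1 -> 'I_m, increasing x -> (EA (u \o x) <-> EA (u' \o x))) ->
      `|feval phi (fun z => c (u (tau z.1)) z.2) -
        feval phi (fun z => c (u' (tau z.1)) z.2)| <= e.
Proof.
move=> e0.
pose kk (i : 'I_(size l)) := projT1 (tnth (in_tuple l) i).
pose ph (i : 'I_(size l)) : formula L ('I_(kk i) * J) := projT2 (tnth (in_tuple l) i).
have /choice[B BP] : forall i, exists B : R,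
    forall t : 'I_(kk i) * J -> M, `|feval (ph i) t| <= B.
  by move=> i; exact: feval_bounded.
pose Bmax := \sum_i `|B i|.
have {}BP i (t : 'I_(kk i) * J -> M) : `|feval (ph i) t| <= Bmax.
  apply: le_trans (BP i t) _; apply: le_trans (ler_norm _) _.
  by rewrite /Bmax (bigD1 i) //= lerDl sumr_ge0.
have [N [d dP]] := discretization Bmax e0.
pose col m : finType := {ffun {i : 'I_(size l) & {ffun 'I_(kk i) -> 'I_m}} -> 'I_N}.
have [V [E VE]] := structural_ramsey EA col.
have [c cP] := coded E.
pose X m (u : 'I_m -> V) : col m :=
  [ffun z : {i : 'I_(size l) & {ffun 'I_(kk i) -> 'I_m}} =>
     d (feval (ph (tag z)) (fun y => c (u (tagged z y.1)) y.2))].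
have [emb [embE embX]] := VE X.
exists (c \o emb); split=> [x incx|i].
  have [lowE highE] := cP (emb \o x); have xE := embE x incx.
  by split=> [/xE /lowE //|nE]; apply: highE => /xE.
suff key m (u u' : 'I_m -> 'I_a) (tau : 'I_(kk i) -> 'I_m) :
    increasing u -> increasing u' ->
    (forall x : 'I_n.+1 -> 'I_m, increasing x -> (EA (u \o x) <-> EA (u' \o x))) ->
    `|feval (ph i) (fun z => c (emb (u (tau z.1))) z.2) -
      feval (ph i) (fun z => c (emb (u' (tau z.1))) z.2)| <= e.
  by move: key; rewrite /ph /kk; case: (tnth _ _).
move=> incu incu' same; apply: dP => //.
have := embX m u u' incu incu' same.
pose z : {i : 'I_(size l) & {ffun 'I_(kk i) -> 'I_m}} := existT _ i (finfun tau).
move=> /ffunP /(_ z); rewrite !ffunE /=.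
have tauE : finfun tau = tau :> (_ -> _) by apply/funext => y; rewrite ffunE.
by rewrite tauE.
Qed.

(** The sets of sequences that code the edges on a finite set, and are indiscernible there up to e
    for finitely many formulas, generate a proper filter. In an ultralimit every e > 0 is reached,
    so the indiscernibility is exact. *)
Lemma coded_indiscernible : exists c : G -> J -> M,
  indiscernible c /\ forall x, gincr x -> codes r s edge c x.
Proof.
have G_hyp := is_Gn1_hypergraph G_limit; have [lin _ _] := G_hyp.
have [x0] := minhabited M; have [cG _ _] := G_limit.
pose task : Type := {k : nat & formula L ('I_k * J)}.
pose base (i : seq {classic G} * seq {classic task} * R) : set (G -> J -> M) :=
  [set t | (forall x, gincr x -> (forall j, (x j : {classic G}) \in i.1.1) ->
              codes r s edge t x) /\
    forall k (phi : formula L ('I_k * J)) (g h : 'I_k -> G),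
      (existT _ k phi : {classic task}) \in i.1.2 ->
      (forall j, (g j : {classic G}) \in i.1.1) ->
      (forall j, (h j : {classic G}) \in i.1.1) -> same_qf_type g h ->
      `|feval phi (fun z => t (g z.1) z.2) - feval phi (fun z => t (h z.1) z.2)|
        <= i.2 ].
pose pos_index : set (seq {classic G} * seq {classic task} * R) := [set i | 0 < i.2].
have base_filter : ProperFilter (filter_from pos_index base).
  apply: filter_from_proper.
    apply: filter_from_filter; first by exists ([::], [::], 1); rewrite /pos_index /=.
    move=> [[A1 l1] e1] [[A2 l2] e2]; rewrite /pos_index /= => e1_gt0 e2_gt0.
    exists (A1 ++ A2, l1 ++ l2, Num.min e1 e2); first by rewrite /= lt_min e1_gt0.
    move=> t [/= t_codes t_ind]; split; split=> /=.
    - by move=> x incx xA; apply: t_codes => // j; rewrite mem_cat xA.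
    - move=> k phi g h phil gA hA gh.
      apply: (@le_trans _ _ (Num.min e1 e2)); last by rewrite ge_min lexx.
      by apply: t_ind => // [|j|j]; rewrite mem_cat ?phil ?gA ?hA.
    - by move=> x incx xA; apply: t_codes => // j; rewrite mem_cat xA orbT.
    - move=> k phi g h phil gA hA gh.
      apply: (@le_trans _ _ (Num.min e1 e2)); last by rewrite ge_min lexx orbT.
      by apply: t_ind => // [|j|j]; rewrite mem_cat ?phil ?gA ?hA orbT.
  move=> [[A l] e]; rewrite /pos_index /= => e0.
  have [a [al [tau [tau' [inca AE _]]]]] :=
    increasing_enumeration lin (fun i => tnth (in_tuple A) i : G).
  have al_inj := lt_increasing_inj lin inca.
  have lift_A m (x : 'I_m -> G) : (forall j, (x j : {classic G}) \in A) ->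
      exists u : 'I_m -> 'I_a, x = al \o u.
    move=> xA; have /choice[u uE] : forall j, exists i, x j = al i.
      move=> j; have /(tnthP (in_tuple A))[i iE] := xA j.
      by exists (tau i); rewrite iE -[LHS]/((fun i => tnth (in_tuple A) i : G) i) AE.
    by exists u; apply/funext.
  have lift_incr m (u : 'I_m -> 'I_a) : gincr (al \o u) -> increasing u.
    by move=> incu i j /incu /(lt_increasingP lin _ _ inca).
  have [c [c_codes c_ind]] :=
    approximately_indiscernible (fun x => edge (al \o x)) l e0.
  pose t (g : G) := if pselect (exists i, al i = g) is left h
    then c (projT1 (cid h)) else (fun=> x0).
  have tE i : t (al i) = c i.
    rewrite /t; case: pselect => [h|[]]; last by exists i.
    by case: cid => i' /= /al_inj ->.
  exists t; split=> /=.
    move=> x incx /lift_A[u xu]; rewrite xu in incx *.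
    have := c_codes u (lift_incr _ _ incx); rewrite /codes.
    suff -> : (fun z => t ((al \o u) z.1) z.2) = (fun z => c (u z.1) z.2) by [].
    by apply/funext => z; rewrite /= tE.
  move=> k phi g h phil gA hA /same_qf_typeP[gh_eq gh_rel].
  have [||m [g' [h' [sg [sg' [incg' inch' gE hE [g'E h'E]]]]]]] :=
      @common_enumeration _ (@glt n G) lin k g h.
  - exact: gh_eq.
  - by move=> i j; have := gh_rel og_lt (tnth [tuple i; j]); rewrite !comp_pair.
  have [|u uE] := lift_A _ g'; first by move=> j; rewrite g'E; exact: gA.
  have [|u' u'E] := lift_A _ h'; first by move=> j; rewrite h'E; exact: hA.
  have incu : increasing u by apply: lift_incr; rewrite -uE.
  have incu' : increasing u' by apply: lift_incr; rewrite -u'E.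
  have /(tnthP (in_tuple l))[i iE] := phil.
  have := c_ind i; rewrite -iE => /(_ m u u' sg incu incu').
  have -> : (fun z => c (u (sg z.1)) z.2) = (fun z => t (g z.1) z.2).
    by apply/funext => z; rewrite gE uE /= tE.
  have -> : (fun z => c (u' (sg z.1)) z.2) = (fun z => t (h z.1) z.2).
    by apply/funext => z; rewrite hE u'E /= tE.
  apply=> x incx; rewrite -[al \o (u \o x)]/((al \o u) \o x).
  rewrite -[al \o (u' \o x)]/((al \o u') \o x) -uE -u'E g'E h'E.
  exact: (gh_rel og_R (sg' \o x)).
have [U [U_ultra U_base]] := ultraFilterLemma base_filter.
have PU : ProperFilter U := ultra_proper.
have U_in A l e : 0 < e -> U (base (A, l, e)).
  by move=> e0; apply: U_base; exists (A, l, e).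
have /countable_injP[code code_inj] : countable [set: G * J].
  by apply: prod_countable => //; exact: countType_countable.
(* The ultrafilter lives on the sequences themselves, so the family to realize consists of the
   evaluations. *)
have [|c cP] := @ultralimit_realized _ L K M _ _ U
  (fun (t : G -> J -> M) (v : G * J) => t v.1 v.2) code K_nat M_sat U_ultra.
  by move=> v v'; apply: code_inj; rewrite in_setT.
have {}cP k (phi : formula L ('I_k * J)) (g : 'I_k -> G) :
    (fun t : G -> J -> M => feval phi (fun z => t (g z.1) z.2)) @ U -->
    feval phi (fun z => c (g z.1, z.2)).
  exact: (cP _ (fun z : 'I_k * J => (g z.1, z.2)) phi).
have mem_codom m (w : 'I_m -> G) j :
    (w j : {classic G}) \in (codom w : seq {classic G}).
  exact: (@codom_f _ {classic G} w j).
exists (fun g j => c (g, j)); split=> [k g h gh phi|x incx].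
  have lim : (fun t : G -> J -> M => `|feval phi (fun z => t (g z.1) z.2) -
      feval phi (fun z => t (h z.1) z.2)|) @ U -->
      `|feval phi (fun z => c (g z.1, z.2)) - feval phi (fun z => c (h z.1, z.2))|.
    by apply: cvg_norm; apply: cvgB; exact: cP.
  apply/eqP; rewrite -subr_eq0 -normr_le0; apply/ler_addgt0Pl => e e0.
  rewrite addr0; apply: (cvgr_to_le lim).
  pose A : seq {classic G} := codom g ++ codom h.
  apply: filterS (U_in A [:: existT _ k phi] e e0) => t [_ /= t_ind].
  apply: t_ind => // [|j|j]; first by rewrite mem_head.
    by rewrite mem_cat mem_codom.
  by rewrite mem_cat mem_codom orbT.
pose A : seq {classic G} := codom x.
have near_codes : U [set t | codes r s edge t x].
  apply: filterS (U_in A [::] 1 ltr01) => t [/= t_codes _].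
  by apply: t_codes => // j; exact: mem_codom.
split=> Ex.
  apply: (cvgr_to_le (cP _ F x)); apply: filterS near_codes => t [t_low _].
  exact: t_low.
apply: (cvgr_to_ge (cP _ F x)); apply: filterS near_codes => t [_ t_high].
exact: t_high.
Qed.

End Coding.

(** One point in each part, forming an edge or not according to [b]: the two versions agree on order
    and parts and differ only in [opg_R]. *)
Definition transversal (n : nat) (b : Prop) : rstruct (Lopg n) :=
  @RStruct (Lopg n) 'I_n.+1 (fun s => match s with
    | opg_lt => fun x : 'I_2 -> _ => (x ord0 < x ord_max)%N
    | opg_R => fun x => b /\ injective x
    | opg_P i => fun x : 'I_1 -> _ => x ord0 = i
    end).

Lemma transversal_partite (n : nat) (b : Prop) :
  ordered_partite_hypergraph (transversal n b).
Proof.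
split.
- by move=> x; exists x; split.
- move=> x s; split=> -[bb x_inj]; split=> // i j.
    move=> ij; rewrite -[i](permKV s) -[j](permKV s); congr (s _).
    by apply: x_inj; rewrite /= !permKV.
  by move=> /x_inj /perm_inj.
- move=> x [_ x_inj] i; have [y xy yx] := injF_bij x_inj.
  exists i; split; first by split=> //; exists (y i).
  by move=> j [_ <-].
- exact: ltn_linear.
- by move=> i j x y ij /= xi yj; move: ij; rewrite -xi -yj.
Qed.

Lemma dependent_of_op_indiscernible (R : realType) (L : signature R) (n : nat)
    (K : Type) (M : mstructure L) (Gp : rstruct (Lopg n)) (G : rstruct (Log n)) :
  small K nat -> saturated K M -> is_Gn1p Gp -> is_Gn1 G ->
  (forall (J : Type) (a : Gp -> J -> M), small K J ->
     indiscernible a -> indiscernible (G := op_reduct Gp) a) ->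
  n_dependent n M.
Proof.
move=> K_nat M_sat Gp_limit G_limit op_ind p q f.
move=> /has_IP_codes[r [s [rs coded]]].
have Gp_hyp := is_Gn1p_hypergraph Gp_limit.
have [cGp _ _] := Gp_limit.
have [c [c_ind c_codes]] := coded_indiscernible K_nat M_sat G_limit coded.
have [iota iota_emb] : exists h : forget_parts Gp -> G, rembedding h.
  apply: is_Gn1_universal => //; exact: forget_parts_hypergraph.
(* A quantifier-free [Lopg n]-type determines the [Log n]-type left after forgetting the parts. *)
have a_ind : @indiscernible (Lopg n) R L M _ Gp (c \o iota).
  move=> k g h /same_qf_typeP[gh_eq gh_rel].
  apply: (c_ind k (iota \o g) (iota \o h)); apply/same_qf_typeP; split=> [i j|[] x].
  - by split=> /(iota_emb.1) /gh_eq E; rewrite /= E.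
  - by rewrite (iota_emb.2 og_lt (g \o x)) (iota_emb.2 og_lt (h \o x));
      exact: (gh_rel opg_lt x).
  - by rewrite (iota_emb.2 og_R (g \o x)) (iota_emb.2 og_R (h \o x));
      exact: (gh_rel opg_R x).
have J_small : small K ('I_p + {i : 'I_n & 'I_(q i)}).
  exact: (small_countable K_nat (countType_countable _)).
have a_op := op_ind _ (c \o iota) J_small a_ind.
have emb_b b : exists e : transversal n b -> Gp, rembedding e.
  apply: is_Gn1p_universal => //; first exact: transversal_partite.
  exact: countType_countable.
have [e1 e1_emb] := emb_b True; have [e0 e0_emb] := emb_b False.
have inc b (e : transversal n b -> Gp) : rembedding e ->
    lt_increasing (@glt n G) (iota \o e).
  move=> e_emb i j ij; apply: ((@glt_embedding _ _ _ iota _ _ iota_emb).2).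
  exact: ((@plt_embedding _ _ _ e i j e_emb).2 ij).
have same : @same_qf_type (Lop n) (op_reduct Gp) n.+1 e1 e0.
  apply/same_qf_typeP; split=> [i j|[|i] x].
  - by split=> [/(e1_emb.1)|/(e0_emb.1)] ->.
  - exact: (iff_trans (e1_emb.2 opg_lt x) (iff_sym (e0_emb.2 opg_lt x))).
  - exact: (iff_trans (e1_emb.2 (opg_P i) x) (iff_sym (e0_emb.2 (opg_P i) x))).
have [low _] := c_codes _ (inc _ _ e1_emb).
have [_ high] := c_codes _ (inc _ _ e0_emb).
have := a_op _ _ _ same; move=> /(_ _) same_F.
have edge1 : @rinterp _ G og_R (iota \o e1).
  apply/(iota_emb.2 og_R e1)/(e1_emb.2 opg_R id); by split.
have edge0 : ~ @rinterp _ G og_R (iota \o e0).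
  by move=> /(iota_emb.2 og_R e0)/(e0_emb.2 opg_R id)[].
(* The value is at least s without the edge and at most r with it; equal types would give s <= r. *)
have := le_trans (high edge0) (le_trans _ (low edge1)).
rewrite -[leLHS]/(feval _ (fun z => (c \o iota) (e0 z.1) z.2)) -same_F lexx.
by rewrite leNgt rs => /(_ isT).
Qed.

Theorem theorem5p23 (R : realType) (L : signature R) (T : theory L) (n : nat)
  (K : Type) (C : mstructure L)
  (Gp : rstruct (Lopg n)) (G : rstruct (Log n))
  (T_complete : complete_theory T) (C_monster : monster_model K T C)
  (Gp_limit : is_Gn1p Gp) (G_limit : is_Gn1 G) :
  [<-> n_dependent n C;
       forall (J : Type) (a : Gp -> J -> C), small K J ->
         indiscernible a -> indiscernible (G := op_reduct Gp) a;
       forall (J : Type) (a : G -> J -> C), small K J ->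
         indiscernible a -> indiscernible (G := o_reduct G) a].
Proof.
have [K_nat _ _ C_sat _] := C_monster.
have op_dep := dependent_of_op_indiscernible K_nat C_sat Gp_limit G_limit.
have dep_order := @order_indiscernible_of_dependent R L n C G G_limit.
have order_op := @op_indiscernible_of_order R L n K C Gp G K_nat Gp_limit G_limit.
(* The list runs through the proved cycle backwards, so each implication is a composite of two. *)
tfae.
- by move=> dep J a _; apply: order_op => J' a' _; exact: dep_order.
- by move=> /op_dep dep J a _; exact: dep_order.
- by move=> ord; apply: op_dep => J a _; exact: order_op.
Qed.
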